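(* Let $f,g\colon\mathcal H\to(-\infty,+\infty]$ and the nonempty closed convex set $S\subseteq\mathcal H$ satisfy Assumptions 1, 2 and 3 stated in the context, and let $(x_n)_{n\in\mathbb N}$ be a sequence generated by the e-PSG algorithm described in the context with $\liminf_{n\to\infty}\tau_n=\overline\tau>0$. Suppose that $g$ is continuously differentiable on an open set containing $S\cap\operatorname{dom}f$, that, with $c:=\frac{\ell\overline\kappa^2}{2m}+\frac{\overline\mu}{2\sqrt{mM}}$ if (BC) holds and $c:=0$ otherwise, the function $h\colon\mathcal H\times\mathcal H\to(-\infty,+\infty]$, $$h(x,y):=\frac{f(x)}{g(x)}+\iota_S(x)+c\|x-y\|^2,$$ satisfies the KL property at $(\overline x,\overline x)$ for all $\overline x\in S\cap\operatorname{dom}f$, and that the set $\{x\in S:\frac{f(x)}{g(x)}\le\frac{f(x_0)}{g(x_0)}\}$ is bounded. Suppose also that there exist $\varepsilon,\ell_g\in\mathbb R_{++}$ such that $$\forall x,y\in S\cap\operatorname{dom}f,\quad \|x-y\|\le\varepsilon\implies\|\nabla g(x)-\nabla g(y)\|\le\ell_g\|x-y\|.$$ Then $\sum_{n=0}^{+\infty}\|x_{n+1}-x_n\|<+\infty$, and the sequence $(x_n)_{n\in\mathbb N}$ converges to a stationary point $x_\infty$ of the problem $\min_{x\in S}\frac{f(x)}{g(x)}$, that is, $x_\infty\in S$ and $0\in\partial_L(\frac fg+\iota_S)(x_\infty)$. Moreover, if $h$ satisfies the KL property with an exponent of $\alpha\le1/2$ at $(\overline x,\overline x)$ for all $\overline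 x\in S\cap\operatorname{dom}f$, then there exist $\gamma_1,\gamma_2\in\mathbb R_{++}$ and $\rho\in(0,1)$ such that, for all $n\in\mathbb N$, $$|h(x_{n+1},x_n)-h(x_\infty,x_\infty)|\le\gamma_1\rho^n\quad\text{and}\quad\|x_n-x_\infty\|\le\gamma_2\rho^{\frac n2}.$$
   Context: $\mathcal H$ is a finite-dimensional real Hilbert space with inner product $\langle\cdot,\cdot\rangle$ and norm $\|\cdot\|$; $\mathbb N=\{0,1,2,\dots\}$; $\mathbb R_+=[0,+\infty)$; $\mathbb R_{++}=(0,+\infty)$. For $h\colon\mathcal H\to[-\infty,+\infty]$, $\operatorname{dom}h=\{x:h(x)<+\infty\}$. $\iota_D$ is the indicator function of a set $D$ ($0$ on $D$, $+\infty$ off $D$). The function $\frac fg+\iota_S$ takes the value $+\infty$ outside $S\cap\operatorname{dom}f$. Subdifferentials (on any finite-dimensional Hilbert space): for $h$ finite at $x$, the Fréchet subdifferential is $\widehat\partial h(x)=\{u:\liminf_{z\to x}\frac{h(z)-h(x)-\langle u,z-x\rangle}{\|z-x\|}\ge0\}$, and the limiting subdifferential $\partial_L h(x)$ is the set of all $u$ for which there exist $x_n\to x$ with $h(x_n)\to h(x)$ and $u_n\in\widehat\partial h(x_n)$ with $u_n\to u$; both are $\varnothing$ where $h$ is not finite. $\operatorname{dom}\partial_Lh=\{x:\partial_Lh(x)\neq\varnothing\}$. $h$ is regular at $x$ (where $h$ is finite) if $\widehat\partial h(x)=\partial_Lh(x)$; a set $D$ is regular at $x\in D$ if $\iota_D$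 is regular at $x$; regular on a set means regular at each of its points. $h$ is strictly differentiable at $x$ if there is $u$ with $\lim_{y,z\to x}\frac{h(y)-h(z)-\langle u,y-z\rangle}{\|y-z\|}=0$. $h$ is weakly convex with modulus $\rho\ge0$ if $\rho$ is the smallest nonnegative constant such that $h+\frac\rho2\|\cdot\|^2$ is convex; $h$ is weakly convex on a set $D$ with modulus $\rho$ if $h+\iota_D$ is weakly convex with modulus $\rho$. KL property: for $\eta\in(0,+\infty]$, $\Phi_\eta$ is the class of continuous concave functions $\varphi\colon[0,\eta)\to\mathbb R_+$ with $\varphi(0)=0$, continuously differentiable on $(0,\eta)$ with $\varphi'>0$. A proper lower semicontinuous $h$ satisfies the KL property at $\overline z\in\operatorname{dom}\partial_Lh$ if there exist a neighborhood $U$ of $\overline z$, $\eta\in(0,+\infty]$ and $\varphi\in\Phi_\eta$ such that $\varphi'(h(z)-h(\overline z))\operatorname{dist}(0,\partial_Lh(z))\ge1$ for all $z\in U$ with $h(\overline z)<h(z)<h(\overline z)+\eta$. If $\varphi$ can be chosen as $\varphi(s)=\gamma s^{1-\alpha}$ for some $\gamma\in\mathbb R_{++}$, $\alpha\in[0,1)$, then $h$ has the KL property at $\overline z$ with an exponent of $\alpha$. Assumption 1: $f=f^{\mathfrak s}+f^{\mathfrak n}$, where $f^{\mathfrak s}\colon\mathcal H\to\mathbb R$ is a continuously differentiable convex function whose gradient is Lipschitz continuous with modulus $\ell$ on $\mathcal H$, $f^{\mathfrak n}\colon\mathcal H\to(-\infty,+\infty]$ is proper lower semicontinuous, $S\cap\operatorname{dom}f\ne\varnothing$,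 and $f(x)\ge0$ for all $x\in S\cap\operatorname{dom}f$. Assumption 2: $g\colon\mathcal H\to(-\infty,+\infty]$ is proper lower semicontinuous, finite and positive on $S$, continuous on an open set containing $S$, and either weakly convex with modulus $\beta$ on an open convex set containing $S$, or regular and weakly convex with modulus $\beta$ on $S$. Assumption 3: $f^{\mathfrak n}=f^{\mathfrak l}+\iota_C$, where $C$ is a nonempty closed subset of $\mathcal H$ such that $C\cap S\ne\varnothing$ and one of the following is satisfied: (a) $f^{\mathfrak l}$ is locally Lipschitz continuous on $\mathcal H$ and $C=S=\mathcal H$; (b) $f^{\mathfrak l}$ is locally Lipschitz continuous on an open set containing $S\cap\operatorname{dom}f$, both $f^{\mathfrak l}$ and $C\cap S$ are regular on $S\cap\operatorname{dom}f$, and $g$ is positive on an open set containing $S\cap\operatorname{dom}f$; (c) $f^{\mathfrak l}$ is strictly differentiable on an open set containing $S\cap\operatorname{dom}f$ and $g$ is positive on an open set containing $S\cap\operatorname{dom}f$. Boundedness condition (BC): there exist $m,M\in\mathbb R_{++}$ such that $m\le g(x)\le M$ for all $x\in S\cap\operatorname{dom}f$. e-PSG algorithm. Step 1: choose $x_{-1}=x_0\in S\cap\operatorname{dom}f$. Let $\delta\in\mathbb R_{++}$, let $\zeta\in\mathbb R_{++}$ satisfy $1-\sqrt\beta\zeta>0$, and let $$\overline\mu\in\left[0,\frac{\delta(1-\sqrt\beta\zeta)\sqrt{mM}}{2M}\right),\qquad \overline\kappa\in\left[0,\sqrt{\frac{m\delta(1-\sqrt\beta\zeta)}{\ell M}-\frac{2m\overline\mu}{\ell\sqrt{mM}}}\right),$$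 with $m,M$ from (BC) (if $\ell=0$, the upper bound for $\overline\kappa$ is read as $+\infty$). In the absence of (BC), $\overline\mu=0$ and $\overline\kappa=0$. Step 2, for $n=0,1,2,\dots$: set $\theta_n=\frac{f(x_n)}{g(x_n)}$, let $g_n\in\partial_Lg(x_n)$, choose $\tau_n\in\mathbb R$ with $0<\tau_n\le 1/\max\{\sqrt\beta\theta_n/\zeta,\delta\}$; let $u_n=x_n+\kappa_n(x_n-x_{n-1})$ with $\kappa_n\in[0,\overline\kappa]$, $v_n=x_n+\mu_n(x_n-x_{n-1})$ with $\mu_n\in[0,\overline\mu\tau_n]$, and find $$x_{n+1}\in\operatorname*{argmin}_{x\in S}\left(f^{\mathfrak n}(x)+f^{\mathfrak s}(u_n)+\langle\nabla f^{\mathfrak s}(u_n),x-u_n\rangle+\frac1{2\tau_n}\|x-v_n-\tau_n\theta_ng_n\|^2+\frac\ell2\|x-u_n\|^2\right).$$ The sequence is assumed to be infinite (the algorithm is run without termination). *)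

(* Defs.v *)
From mathcomp Require Export all_boot all_order all_algebra sesquilinear.
From mathcomp Require Export all_classical all_reals all_analysis.
Export Order.TTheory GRing.Theory Num.Theory.
Export numFieldNormedType.Exports.

Set Implicit Arguments.
Unset Strict Implicit.
Unset Printing Implicit Defensive.

Local Open Scope classical_set_scope.
Local Open Scope ring_scope.

(* A finite-dimensional real Hilbert space is a normed module with a finite
   generating family, whose norm is induced by an inner product
   [ip : {dot H for idfun}]; completeness is then automatic. *)
Definition finite_dim (R : realType) (H : lmodType R) : Prop :=
  exists (n : nat) (b : 'I_n -> H),
    forall x, exists a : 'I_n -> R, x = \sum_(i < n) a i *: b i.

Definition ipnorm (R : realType) (V : lmodType R) (ip : V -> V -> R) (x : V) : R :=
  Num.sqrt (ip x x).

Definition norm_of_ip (R : realType) (H : normedModType R) (ip : H -> H -> R)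
  : Prop := forall x : H, `|x| = ipnorm ip x.

(* The library norm on [H * H] is the max norm: it induces the right topology,
   but not the Hilbert norm. This is why the notions below that are also needed
   on [H * H] take the inner product as a parameter and use [ipnorm]. *)
Definition ip2 (R : realType) (H : lmodType R) (ip : H -> H -> R)
    (p q : H * H) : R := ip p.1 q.1 + ip p.2 q.2.

Definition edom (R : realType) (T : Type) (h : T -> \bar R) : set T :=
  [set x | (h x < +oo)%E].

Definition proper (R : realType) (T : Type) (h : T -> \bar R) : Prop :=
  (forall x, h x != -oo%E) /\ (exists x, (h x < +oo)%E).

Definition iota_ (R : realType) (T : Type) (D : set T) (x : T) : \bar R :=
  if `[< D x >] then 0%E else +oo%E.

(* Only meant for functions which do not take the value -oo. *)
Definition convex_efun (R : realType) (V : lmodType R) (h : V -> \bar R) : Prop :=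
  forall (x y : V) (t : R), 0 <= t <= 1 ->
    (h (t *: x + (1 - t) *: y)%R <= t%:E * h x + (1 - t)%:E * h y)%E.

Definition weakly_convex (R : realType) (H : normedModType R)
    (h : H -> \bar R) (rho : R) : Prop :=
  let reg (r : R) (x : H) := (h x + (r / 2 * `|x| ^+ 2)%:E)%E in
  [/\ 0 <= rho, convex_efun (reg rho) &
      forall r, 0 <= r -> convex_efun (reg r) -> rho <= r].

Definition weakly_convex_on (R : realType) (H : normedModType R)
    (h : H -> \bar R) (D : set H) (rho : R) : Prop :=
  weakly_convex (fun x => h x + iota_ R D x)%E rho.

Definition locally_lipschitz_on (R : realType) (H : normedModType R)
    (h : H -> \bar R) (O : set H) : Prop :=
  (forall x, O x -> h x \is a fin_num) /\
  [locally [lipschitz (fine (h x) : R^o) | x in O]].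

Definition is_gradient (R : realType) (H : normedModType R) (ip : H -> H -> R)
    (h : H -> R^o) (x u : H) : Prop :=
  differentiable h x /\ (forall v, 'd h x v = ip u v).

Definition strictly_differentiable (R : realType) (H : normedModType R)
    (ip : H -> H -> R) (h : H -> \bar R) (x : H) : Prop :=
  (\forall y \near x, h y \is a fin_num) /\
  (exists u : H,
    (fun p : H * H =>
       (fine (h p.1) - fine (h p.2) - ip u (p.1 - p.2)) / ipnorm ip (p.1 - p.2))
      @ within [set p | p.1 != p.2] (nbhs (x, x)) --> (0 : R)).

Definition frechet_subdiff (R : realType) (V : normedModType R)
    (ip : V -> V -> R) (h : V -> \bar R) (x : V) : set V :=
  [set u | h x \is a fin_num /\
    (0 <= limf_einf (fun z => (h z - h x - (ip u (z - x))%:E)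
                                * ((ipnorm ip (z - x))^-1)%:E) x^')%E].

Definition limiting_subdiff (R : realType) (V : normedModType R)
    (ip : V -> V -> R) (h : V -> \bar R) (x : V) : set V :=
  [set u | h x \is a fin_num /\
    exists xs us : nat -> V,
      [/\ xs @ \oo --> x, h (xs n) @[n --> \oo] --> h x,
          forall n, frechet_subdiff ip h (xs n) (us n) & us @ \oo --> u]].

Definition dom_subdiff (R : realType) (V : normedModType R)
    (ip : V -> V -> R) (h : V -> \bar R) : set V :=
  [set x | limiting_subdiff ip h x !=set0].

Definition regular_at (R : realType) (V : normedModType R)
    (ip : V -> V -> R) (h : V -> \bar R) (x : V) : Prop :=
  h x \is a fin_num /\ frechet_subdiff ip h x = limiting_subdiff ip h x.

Definition regular_set_at (R : realType) (V : normedModType R)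
    (ip : V -> V -> R) (D : set V) (x : V) : Prop :=
  D x /\ regular_at ip (iota_ R D) x.

Definition desingularizing (R : realType) (eta : \bar R) (phi : R -> R) : Prop :=
  let D : set R := [set s | 0 <= s /\ (s%:E < eta)%E] in
  [/\ {within D, continuous phi},
      convex_function (D : set (convex_lmodType R^o)) (fun s => - phi s),
      phi 0 = 0,
      forall s, D s -> 0 <= phi s &
      forall s : R, 0 < s -> (s%:E < eta)%E ->
        [/\ derivable phi s 1, {for s, continuous (derive1 phi)} & 0 < derive1 phi s]].

(* [dist0 A] is the distance from 0 to A; it is +oo when A is empty. *)
Definition dist0 (R : realType) (V : lmodType R) (ip : V -> V -> R) (A : set V)
  : \bar R := ereal_inf [set (ipnorm ip u)%:E | u in A].

Definition KL_with (R : realType) (V : normedModType R) (ip : V -> V -> R)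
    (h : V -> \bar R) (zb : V) (phi : R -> R) : Prop :=
  [/\ proper h, lower_semicontinuous h, dom_subdiff ip h zb &
    exists (U : set V) (eta : \bar R),
      [/\ nbhs zb U, (0 < eta)%E, desingularizing eta phi &
        forall z, U z -> (h zb < h z)%E -> (h z < h zb + eta)%E ->
          (1 <= (derive1 phi (fine (h z - h zb)%E))%:E
                  * dist0 ip (limiting_subdiff ip h z))%E]].

Definition KL (R : realType) (V : normedModType R) (ip : V -> V -> R)
    (h : V -> \bar R) (zb : V) : Prop :=
  exists phi : R -> R, KL_with ip h zb phi.

Definition KL_exponent (R : realType) (V : normedModType R) (ip : V -> V -> R)
    (h : V -> \bar R) (zb : V) (alpha : R) : Prop :=
  0 <= alpha < 1 /\
  exists2 gam : R, 0 < gam &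
    KL_with ip h zb (fun s => gam * s `^ (1 - alpha)).

(* This is f / g + iota_S, with the convention that it is +oo off S and dom f. *)
Definition ratio (R : realType) (H : Type) (f g : H -> \bar R) (S : set H)
    (x : H) : \bar R :=
  if `[< (S `&` edom f) x >] then (fine (f x) / fine (g x))%:E else +oo%E.

Definition merit (R : realType) (H : normedModType R) (f g : H -> \bar R)
    (S : set H) (c : R) (p : H * H) : \bar R :=
  (ratio f g S p.1 + (c * `|p.1 - p.2| ^+ 2)%:E)%E.

Definition stationary (R : realType) (H : normedModType R) (ip : H -> H -> R)
    (f g : H -> \bar R) (S : set H) (x : H) : Prop :=
  S x /\ limiting_subdiff ip (ratio f g S) x 0.

Definition assumption1 (R : realType) (H : normedModType R) (ip : H -> H -> R)
    (S : set H) (f : H -> \bar R) (fs : H -> R) (dfs : H -> H)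
    (fn : H -> \bar R) (l : R) : Prop :=
  [/\ forall x, f x = ((fs x)%:E + fn x)%E,
      [/\ forall x, is_gradient ip fs x (dfs x), continuous dfs,
          convex_function ([set: H] : set (convex_lmodType H)) fs, 0 <= l &
          forall x y, `|dfs x - dfs y| <= l * `|x - y| ],
      proper fn /\ lower_semicontinuous fn,
      S `&` edom f !=set0 &
      forall x, (S `&` edom f) x -> (0 <= f x)%E ].

Definition assumption2 (R : realType) (H : normedModType R) (ip : H -> H -> R)
    (S : set H) (g : H -> \bar R) (beta : R) : Prop :=
  [/\ proper g /\ lower_semicontinuous g,
      forall x, S x -> g x \is a fin_num /\ (0 < g x)%E,
      exists O : set H, [/\ open O, S `<=` O & forall x, O x -> {for x, continuous g}] &
      (exists O : set H,
        [/\ open O, convex_set (O : set (convex_lmodType H)), S `<=` O &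
            weakly_convex_on g O beta]) \/
      ((forall x, S x -> regular_at ip g x) /\ weakly_convex_on g S beta) ].

Definition positive_near (R : realType) (H : normedModType R)
    (g : H -> \bar R) (A : set H) : Prop :=
  exists O : set H, [/\ open O, A `<=` O & forall x, O x -> (0 < g x)%E].

Definition assumption3 (R : realType) (H : normedModType R) (ip : H -> H -> R)
    (S : set H) (f g fn fl : H -> \bar R) (C : set H) : Prop :=
  [/\ (forall x, fl x != -oo%E) /\ (forall x, fn x = (fl x + iota_ R C x)%E),
      C !=set0 /\ closed C,
      C `&` S !=set0 &
      [\/ [/\ locally_lipschitz_on fl [set: H], C = [set: H] & S = [set: H]],
          [/\ exists O : set H,
                [/\ open O, S `&` edom f `<=` O & locally_lipschitz_on fl O],
              forall x, (S `&` edom f) x ->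
                regular_at ip fl x /\ regular_set_at ip (C `&` S) x &
              positive_near g (S `&` edom f)] |
          (exists O : set H,
             [/\ open O, S `&` edom f `<=` O &
                 forall x, O x -> strictly_differentiable ip fl x]) /\
          positive_near g (S `&` edom f) ] ].

(* [dg] is constrained only on the open set, where it is the gradient of g. *)
Definition C1_near (R : realType) (H : normedModType R) (ip : H -> H -> R)
    (g : H -> \bar R) (dg : H -> H) (A : set H) : Prop :=
  exists O : set H,
    [/\ open O, A `<=` O &
      forall x, O x -> [/\ g x \is a fin_num, is_gradient ip (fine \o g) x (dg x) &
                           {for x, continuous dg}] ].

Definition BC_with (R : realType) (H : Type) (f g : H -> \bar R) (S : set H)
    (m M : R) : Prop :=
  [/\ 0 < m, 0 < M &
      forall x, (S `&` edom f) x -> (m%:E <= g x)%E /\ (g x <= M%:E)%E].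

Definition BC (R : realType) (H : Type) (f g : H -> \bar R) (S : set H) : Prop :=
  exists m M : R, BC_with f g S m M.

(* m and M are irrelevant when BC fails. *)
Definition ePSG_parameters (R : realType) (H : Type) (f g : H -> \bar R)
    (S : set H) (l beta m M delta zeta mub kappab : R) : Prop :=
  [/\ 0 < delta, 0 < zeta, 0 < 1 - Num.sqrt beta * zeta,
      BC f g S ->
        [/\ BC_with f g S m M,
            0 <= mub < delta * (1 - Num.sqrt beta * zeta) * Num.sqrt (m * M)
                         / (2 * M),
            0 <= kappab &
            l != 0 ->
            kappab < Num.sqrt (m * delta * (1 - Num.sqrt beta * zeta) / (l * M)
                               - 2 * m * mub / (l * Num.sqrt (m * M))) ] &
      ~ BC f g S -> mub = 0 /\ kappab = 0 ].

Definition merit_coef (R : realType) (H : Type) (f g : H -> \bar R) (S : set H)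
    (l m M mub kappab : R) : R :=
  if `[< BC f g S >]
  then l * kappab ^+ 2 / (2 * m) + mub / (2 * Num.sqrt (m * M))
  else 0.

Definition argmin (R : realType) (T : Type) (S : set T) (h : T -> \bar R) : set T :=
  [set x | S x /\ forall y, S y -> (h x <= h y)%E].

(* [x n.-1] is x_{n-1}, since [0.-1 = 0] encodes the initialization x_{-1} = x_0. *)
Definition extrapolate (R : realType) (H : lmodType R) (x : nat -> H)
    (w : nat -> R) (n : nat) : H := x n + w n *: (x n - x n.-1).

Definition ePSG_objective (R : realType) (H : normedModType R) (ip : H -> H -> R)
    (fs : H -> R) (dfs : H -> H) (fn : H -> \bar R) (l : R)
    (tau theta : R) (u v gn : H) (y : H) : \bar R :=
  (fn y + (fs u + ip (dfs u) (y - u)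
           + 1 / (2 * tau) * `|y - v - (tau * theta) *: gn| ^+ 2
           + l / 2 * `|y - u| ^+ 2)%:E)%E.

Definition ePSG_sequence (R : realType) (H : normedModType R) (ip : H -> H -> R)
    (S : set H) (f g : H -> \bar R) (fs : H -> R) (dfs : H -> H)
    (fn : H -> \bar R) (l beta delta zeta mub kappab : R)
    (x gs : nat -> H) (tau kappa mu : nat -> R) : Prop :=
  let theta n := fine (f (x n)) / fine (g (x n)) in
  (S `&` edom f) (x 0%N) /\
  forall n : nat,
    [/\ limiting_subdiff ip g (x n) (gs n),
        0 < tau n <= 1 / Num.max (Num.sqrt beta * theta n / zeta) delta,
        0 <= kappa n <= kappab,
        0 <= mu n <= mub * tau n &
        argmin S
          (ePSG_objective ip fs dfs fn l (tau n) (theta n)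
             (extrapolate x kappa n) (extrapolate x mu n) (gs n))
          (x n.+1) ].

(* Main.v *)
(* Comparing the prox objective at x_{n+1} and x_n, with the descent lemma for f^s and
   weak convexity of g, shows that h(x_n, x_{n-1}) decreases by at least
   a |x_{n+1} - x_n|^2; the parameter bounds are exactly what makes a > 0. Hence the
   steps tend to 0 and the h-values converge.

   Since f^s is convex, minimality of x_{n+1} gives a global quadratic minorant of f on
   S /\ dom f, and as g is C^1 the quotient rule turns it into a Frechet subgradient of
   h at (x_{n+1}, x_n); no calculus of limiting subdifferentials is needed. Its norm is
   O(|x_{n+1} - x_n| + |x_n - x_{n-1}|) near a cluster point, because f is Lipschitz on
   S /\ dom f there (the only use of Assumption 3) and the gradient of g is Lipschitz.

   Lower semicontinuity and minimality identify the limit of the h-values with the value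
   of h at a cluster point. The KL inequality at this single point then keeps the
   iterates in any prescribed ball around it, so no uniformized KL property is needed.
   For exponents at most 1/2 the gap s_n to the limit satisfies
   s_{n+2} <= b (s_n - s_{n+2}) eventually, whence the geometric rates. *)

(* The subgradient of h at (x_{n+1}, x_n) sets theta_n grad g(x_n), inherited from the proximal
   step, against theta_{n+1} grad g(x_{n+1}), produced by the quotient rule. Neither term tends to 0
   in general, so the error bound hinges on theta_n - theta_{n+1} = O(|x_{n+1} - x_n|). Descent of h
   controls this difference from one side only; this is why f has to be Lipschitz near the cluster
   point. With momentum, theta_n itself need not decrease: the extrapolation errors are paid in
   units of the previous step squared, and the summand c|x - y|^2 of h stores exactly what the next
   iteration may consume. Without (BC) there is no momentum, theta_n decreases, and the bounded
   level set supplies the missing upper bound of g along the iterates. *)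
Require Import Defs.
From mathcomp Require Import ring lra.

Set Implicit Arguments.
Unset Strict Implicit.
Unset Printing Implicit Defensive.

Local Open Scope classical_set_scope.
Local Open Scope ring_scope.

(** * Inner products and compactness *)

Section InnerProduct.
Context {R : realType} {H : normedModType R} (ip : {dot H for idfun}).
Hypothesis ipE : norm_of_ip ip.

Lemma ipC u v : ip u v = ip v u.
Proof. by have /= := hermC ip u v; rewrite expr0 mul1r. Qed.

Lemma ipDr w u v : ip w (u + v) = ip w u + ip w v.
Proof. exact: (linearD (ip w)). Qed.

Lemma ipZr w a u : ip w (a *: u) = a * ip w u.
Proof. exact: linearZr_LR. Qed.

Lemma ipNr w u : ip w (- u) = - ip w u.
Proof. by rewrite -scaleN1r ipZr mulN1r. Qed.

Lemma ipBr w u v : ip w (u - v) = ip w u - ip w v.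
Proof. by rewrite ipDr ipNr. Qed.

Lemma ip0r w : ip w 0 = 0.
Proof. by rewrite -(scale0r 0) ipZr mul0r. Qed.

Lemma ipDl w u v : ip (u + v) w = ip u w + ip v w.
Proof. by rewrite ipC ipDr !(ipC w). Qed.

Lemma ipZl w a u : ip (a *: u) w = a * ip u w.
Proof. by rewrite ipC ipZr ipC. Qed.

Lemma ipNl w u : ip (- u) w = - ip u w.
Proof. by rewrite ipC ipNr ipC. Qed.

Lemma ipBl w u v : ip (u - v) w = ip u w - ip v w.
Proof. by rewrite ipDl ipNl. Qed.

Lemma ip_ge0 u : 0 <= ip u u.
Proof.
have [->|u0] := eqVneq u 0; first by rewrite ip0r.
exact/ltW/neq0_dnorm_gt0.
Qed.

Lemma ip_norm u : ip u u = `|u| ^+ 2.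
Proof. by rewrite ipE sqr_sqrtr// ip_ge0. Qed.

Lemma norm_ip u v : `|ip u v| <= `|u| * `|v|.
Proof.
rewrite -[leLHS]ger0_norm// -(@ger0_norm _ (`|u| * _)) ?mulr_ge0//.
rewrite -ler_sqr ?nnegrE// !normr_id !real_normK ?num_real// exprMn -!ip_norm.
have [->|v0] := eqVneq v 0; first by rewrite !ip0r expr0n/= mulr0.
have vv0 : 0 < ip v v by exact: neq0_dnorm_gt0.
(* Cauchy-Schwarz is the nonnegativity of this square after the factor [ip v v] is cancelled. *)
have := ip_ge0 (ip v v *: u - ip u v *: v).
rewrite !(ipBl, ipBr, ipZl, ipZr) (ipC v u).
set a := ip u u; set b := ip u v; set c := ip v v.
rewrite [X in 0 <= X](_ : _ = c * (a * c - b ^+ 2)); last by ring.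
by rewrite pmulr_rge0// subr_ge0.
Qed.

Lemma ip_le u v : ip u v <= `|u| * `|v|.
Proof. exact: le_trans (ler_norm _) (norm_ip u v). Qed.

Lemma ip_ge u v : - (`|u| * `|v|) <= ip u v.
Proof. by rewrite lerNl; apply: le_trans (norm_ip u v); rewrite -normrN ler_norm. Qed.

Lemma sqnormD u v : `|u + v| ^+ 2 = `|u| ^+ 2 + 2 * ip u v + `|v| ^+ 2.
Proof. by rewrite -!ip_norm ipDl !ipDr (ipC v u); ring. Qed.

Lemma sqnormB u v : `|u - v| ^+ 2 = `|u| ^+ 2 - 2 * ip u v + `|v| ^+ 2.
Proof. by rewrite sqnormD ipNr normrN mulrN. Qed.

End InnerProduct.

Section BolzanoWeierstrass.
Context {R : realType} {H : normedModType R} (ip : {dot H for idfun}).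
Hypothesis ipE : norm_of_ip ip.

(** Gram-Schmidt along the generating family: the induction keeps an orthonormal family that
    reproduces the first [j] generators. A generator whose residual [r] vanishes adds no vector,
    which takes care of linear dependence. *)
Lemma orthonormal_generating : finite_dim H -> exists (k : nat) (e : 'I_k -> H),
  (forall i j, ip (e i) (e j) = (i == j)%:R) /\
  (forall x, x = \sum_(i < k) ip x (e i) *: e i).
Proof.
move=> [n [b bgen]].
suff G j : (j <= n)%N -> exists (k : nat) (e : 'I_k -> H),
  (forall i j, ip (e i) (e j) = (i == j)%:R) /\
  (forall i : 'I_n, (i < j)%N -> b i = \sum_(l < k) ip (b i) (e l) *: e l).
  have [k [e [oe ge]]] := G n (leqnn n).
  exists k, e; split=> // x; have [a ->] := bgen x.
  under [RHS]eq_bigr => l _ do rewrite ipC raddf_sum scaler_suml.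
  rewrite exchange_big/=; apply: eq_bigr => i _.
  rewrite {1}ge// scaler_sumr; apply: eq_bigr => l _.
  by rewrite scalerA ipZr ipC.
elim: j => [_|j IH jn].
  exists 0%N, (fun _ => 0); split=> [[]//|i]; by rewrite ltn0.
have [k [e [oe ge]]] := IH (ltnW jn).
pose bj := b (Ordinal jn).
pose r := bj - \sum_(l < k) ip bj (e l) *: e l.
have bjE : bj = r + \sum_(l < k) ip bj (e l) *: e l by rewrite subrK.
have re i : ip r (e i) = 0.
  rewrite ipBl ipC [X in _ - X]ipC raddf_sum/= (bigD1 i)//= big1 => [|l li].
    by rewrite ipZr oe eqxx mulr1 addr0 (ipC ip bj) subrr.
  by rewrite ipZr oe eq_sym (negbTE li) mulr0.
have [r0|r0] := eqVneq r 0.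
  exists k, e; split=> // i; rewrite ltnS leq_eqVlt => /orP[/eqP ij|/ge//].
  have -> : b i = bj by congr b; exact: val_inj.
  by rewrite [LHS]bjE r0 add0r.
have nr0 : `|r| != 0 by rewrite normr_eq0.
pose e' (i : 'I_k.+1) := if unlift ord_max i is Some l then e l else `|r|^-1 *: r.
have e'w l : e' (widen_ord (leqnSn k) l) = e l.
  rewrite /e'; have -> : widen_ord (leqnSn k) l = lift ord_max l.
    by apply: val_inj; rewrite /= /bump leqNgt ltn_ord.
  by rewrite liftK.
have e'm : e' ord_max = `|r|^-1 *: r by rewrite /e' unlift_none.
exists k.+1, e'; split.
  move=> i i'; rewrite /e'; case: unliftP => [l ->|->]; case: unliftP => [l' ->|->].
  - by rewrite oe (inj_eq lift_inj).
  - by rewrite ipZr ipC re mulr0 eq_sym (negbTE (neq_lift _ _)).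
  - by rewrite ipZl re mulr0 (negbTE (neq_lift _ _)).
  - rewrite ipZl ipZr ip_norm// eqxx [RHS]/=.
    by rewrite expr2 mulKf// mulVf.
move=> i; rewrite ltnS leq_eqVlt => /orP[/eqP ij|ij].
  have -> : b i = bj by congr b; exact: val_inj.
  rewrite big_ord_recr/=; under eq_bigr do rewrite e'w.
  rewrite e'm addrC; rewrite [LHS]bjE; congr (_ + _).
  rewrite ipZr scalerA {1}bjE ipDl ip_norm//.
  have -> : ip (\sum_(l < k) ip bj (e l) *: e l) r = 0.
    by rewrite ipC raddf_sum/= big1// => l _; rewrite ipZr re mulr0.
  by rewrite addr0 -[LHS]scale1r; congr (_ *: _); field.
rewrite big_ord_recr/=; under eq_bigr do rewrite e'w.
rewrite -ge// e'm ipZr {3}(ge _ ij).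
have -> : ip (\sum_(l < k) ip (b i) (e l) *: e l) r = 0.
  by rewrite ipC raddf_sum/= big1// => l _; rewrite ipZr re mulr0.
by rewrite mulr0 scale0r addr0.
Qed.

(** Orthonormal coordinates are bounded by the norm, so the sequence lies in the image of a cube
    under the continuous linear map [phi]; compactness is imported from row vectors. *)
Lemma bounded_cluster (x : nat -> H) (B : R) : finite_dim H ->
  (forall n, `|x n| <= B) ->
  exists xb, forall r N, 0 < r -> exists n, (N <= n)%N /\ `|x n - xb| < r.
Proof.
move=> fd xB; have [k [e [oe ge]]] := orthonormal_generating fd.
pose phi (v : 'rV[R]_k) : H := \sum_(i < k) v ord0 i *: e i.
have cphi : continuous phi.
  rewrite /phi; apply: continuous_big => [|i _ v]; first exact: add_continuous.
  by have := @coord_continuous R 1 k ord0 i v; exact: (@cvgZr_tmp _ _ _ (nbhs v)).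
have cK : compact [set v : 'rV[R]_k | forall i, v ord0 i \in `[- B, B]].
  apply: (@rV_compact _ _ (fun=> `[- B, B]%classic)) => _.
  exact: segment_compact.
pose K := phi @` [set v : 'rV[R]_k | forall i, v ord0 i \in `[- B, B]].
have cpK : compact K.
  by apply: continuous_compact => //; exact: continuous_subspaceT.
have Kx n : K (x n).
  exists (\row_i ip (x n) (e i)) => /=.
    move=> i; rewrite mxE in_itv/= -ler_norml.
    apply: le_trans (norm_ip ipE _ _) _.
    have -> : `|e i| = 1 by rewrite ipE /ipnorm oe eqxx sqrtr1.
    by rewrite mulr1.
  by rewrite /phi [RHS]ge; apply: eq_bigr => i _; rewrite mxE.
have [|xb [_ clx]] := cpK (x @ \oo) (fmap_proper_filter x _).
  by exists 0%N => // n _; exact: Kx.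
exists xb => r N r0.
have [| |_ [[n Nn <-] /= xbn]] := clx (x @` [set n | (N <= n)%N]) (ball xb r).
- by exists N => // n /= Nn; exists n.
- by apply/nbhs_ballP; exists r.
exists n; split=> //; by move: xbn; rewrite -ball_normE /= distrC.
Qed.

End BolzanoWeierstrass.

(** * First-order expansions and the KL argument *)

Section Expansion.
Context {R : realType}.

Lemma differentiable_expansion (V : normedModType R) (F : V -> R^o) (x : V) :
  differentiable F x -> forall e, 0 < e -> exists2 r, 0 < r &
    forall z, `|z - x| < r -> `|F z - F x - 'd F x (z - x)| <= e * `|z - x|.
Proof.
move=> /diff_locallyxP [_ dF] e e0.
have /eqaddoP dF' : _ = _ + [o_ (0 : V) id of _] := funext dF.
have /nbhs_norm0P[r /= r0 Hr] := dF' _ e0.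
exists r => // z zr; have /= := Hr (z - x) zr.
by rewrite !fctE subrK opprD addrA.
Qed.

Lemma derivable_expansion (F : R -> R) (x : R) :
  derivable F x 1 -> forall e, 0 < e -> exists2 r, 0 < r &
    forall z, `|z - x| < r -> `|F z - F x - derive1 F x * (z - x)| <= e * `|z - x|.
Proof.
move=> /derivable1_diffP dF e /(differentiable_expansion dF)[r r0 Hr].
exists r => // z /Hr; rewrite derive1E deriveE// [X in _ -> `|_ - X| <= _]mulrC.
have -> : 'd F x (z - x) = (z - x) *: 'd F x 1 by rewrite -linearZ/= [_ *: 1]mulr1.
by [].
Qed.

(** Common last step of the tangent inequalities below: convexity along a segment plus a first-order
    expansion at one end gives the premise, and dividing by [t] gives the slope. *)
Lemma le_slope (A D : R) :
  (forall e, 0 < e -> exists2 r, 0 < r & forall t, 0 < t -> t < r ->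
     t * A <= t * D + e * t) -> A <= D.
Proof.
move=> AD; apply/ler_addgt0Pr => e /AD[r r0 /(_ (r / 2))].
have r20 : 0 < r / 2 by rewrite divr_gt0.
by move=> /(_ r20); rewrite [e * _]mulrC -mulrDr ler_pM2l// => -> //; lra.
Qed.

Lemma convex_functionP (V : lmodType R) (D : set V) (F : V -> R) :
  convex_function (D : set (convex_lmodType V)) F ->
  forall t x y, 0 <= t <= 1 -> D x -> D y ->
    F (t *: x + (1 - t) *: y) <= t * F x + (1 - t) * F y.
Proof.
move=> cF t x y /andP[t0 t1] Dx Dy.
by have := cF (Itv01 t0 t1) x y; rewrite !inE => /(_ Dx Dy).
Qed.

End Expansion.

Section KLConvergence.
Context {R : realType}.

(** Concavity keeps [phi] below its tangent at [s]. Only the derivative at [s > 0] enters, so [t]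
    may be 0, where [phi] can have infinite slope. *)
Lemma desingularizing_slope (eta : \bar R) (phi : R -> R) s t :
  desingularizing eta phi -> 0 < s -> (s%:E < eta)%E -> 0 <= t <= s ->
  derive1 phi s * (s - t) <= phi s - phi t.
Proof.
move=> [_ cphi _ _ dphi] s0 seta /andP[t0 ts].
have [ds _ _] := dphi _ s0 seta.
apply: le_slope => e e0.
(* Dividing by [1 + (s - t)] instead of [s - t] covers [s = t] without a case split. *)
have [] := derivable_expansion ds (e := e / (1 + (s - t))).
  by rewrite divr_gt0//; lra.
move=> r r0 Hr; exists (Num.min 1 (r / (1 + (s - t)))).
  by rewrite lt_min ltr01 divr_gt0//; lra.
move=> l l0; rewrite lt_min => /andP[l1]; rewrite ltr_pdivlMr; last by lra.
move=> lr.
have /= := convex_functionP cphi (t := l) (x := t) (y := s).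
rewrite (ltW l0) (ltW l1) (ltW s0) seta t0 => /(_ isT).
have teta : (t%:E < eta)%E by apply: le_lt_trans seta; rewrite lee_fin.
move=> /(_ (conj isT teta) (conj isT isT)).
have -> : l *: t + (1 - l) *: s = s - l * (s - t) :> R.
  by rewrite /GRing.scale/=; ring.
have := Hr (s - l * (s - t)).
have -> : s - l * (s - t) - s = - (l * (s - t)) by ring.
rewrite normrN ger0_norm; last by rewrite mulr_ge0 ?subr_ge0// ltW.
have H1 : l * (s - t) < r by apply: le_lt_trans lr; rewrite ler_pM2l//; lra.
move=> /(_ H1); rewrite ler_norml => /andP[K1 K2] K3.
have K4 : e / (1 + (s - t)) * (l * (s - t)) <= e * l.
  have -> : e / (1 + (s - t)) * (l * (s - t)) = e * l * ((s - t) / (1 + (s - t))).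
    by ring.
  by rewrite ler_piMr ?mulr_ge0 ?(ltW e0) ?(ltW l0)// ler_pdivrMr; lra.
lra.
Qed.

Lemma desingularizing_small (eta : \bar R) (phi : R -> R) :
  (0 < eta)%E -> desingularizing eta phi -> forall e, 0 < e ->
  exists2 q, 0 < q &
    forall t, 0 <= t -> t < q -> (t%:E < eta)%E /\ 0 <= phi t < e.
Proof.
move=> eta0 [cphi _ phi0 phige0 _] e e0.
have [q1 q10 Hq1] : exists2 q, 0 < q & forall t : R, t < q -> (t%:E < eta)%E.
  move: eta0; case: eta {cphi phige0} => [y| |]//.
    by rewrite lte_fin => y0; exists y => // t; rewrite lte_fin.
  by move=> _; exists 1 => // t _; rewrite ltry.
pose A := [set s : R | 0 <= s /\ (s%:E < eta)%E].
have A0 : A 0 by split.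
have /subspace_continuousP/(_ 0 A0)/cvgrPdist_lt/(_ e e0) := cphi.
move=> /nbhs_norm0P[q2 /= q20 Hq2].
exists (Num.min q1 q2); first by rewrite lt_min q10.
move=> t t0; rewrite lt_min => /andP[/Hq1 teta tq2]; split=> //.
rewrite phige0//=.
have : `|phi 0 - phi t| < e by apply: Hq2; rewrite /= ?ger0_norm.
by rewrite phi0 sub0r normrN ger0_norm ?phige0.
Qed.

(** Here [p] stands for phi(s2) - phi(s3) and [dphi] for phi'(s2). Descent, concavity and the KL
    inequality give D2^2 <= (D1 + D0) (K / a) p, and sqrt(w q) <= w / 4 + q ends the proof. The
    weight 1/4 leaves a total of 1/2 < 1 on the two earlier steps, so that the steps can be
    summed. *)
Lemma KL_step (a K D0 D1 D2 s2 s3 p dphi : R) :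
  0 < a -> 0 < K -> 0 <= D0 -> 0 <= D1 -> 0 <= D2 ->
  s3 + a * D2 ^+ 2 <= s2 -> 0 <= s3 -> 
  dphi * (s2 - s3) <= p -> 1 <= dphi * (K * (D1 + D0)) ->
  D2 <= (D1 + D0) / 4 + K / a * p.
Proof.
move=> a0 K0 D00 D10 D20 hdec s30 hp hKL.
have aD2 : 0 <= a * D2 ^+ 2 by rewrite mulr_ge0 ?sqr_ge0 ?ltW.
have s23 : 0 <= s2 - s3 by lra.
have w0 : 0 <= K * (D1 + D0) by rewrite mulr_ge0 ?addr_ge0// ltW.
have h1 : s2 - s3 <= K * (D1 + D0) * p.
  apply: le_trans (ler_wpM2l w0 hp).
  by rewrite mulrA [_ * dphi]mulrC; apply: ler_peMl.
have p0 : 0 <= K / a * p.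
  rewrite mulr_ge0 ?divr_ge0 ?(ltW K0) ?(ltW a0)//; apply: le_trans hp; rewrite mulr_ge0//.
  have [//|d0] := ltP 0 dphi; first exact: ltW.
  by have := mulr_le0_ge0 d0 w0; lra.
have h2 : D2 ^+ 2 <= (D1 + D0) * (K / a * p).
  rewrite -(ler_pM2l a0).
  have -> : a * ((D1 + D0) * (K / a * p)) = K * (D1 + D0) * p by field; lra.
  lra.
rewrite -ler_sqr ?nnegrE//; last by rewrite addr_ge0// divr_ge0// addr_ge0.
apply: le_trans h2 _; rewrite -subr_ge0.
set w := D1 + D0; set q := K / a * p.
have -> : (w / 4 + q) ^+ 2 - w * q = (w / 4 - q) ^+ 2 by field.
exact: sqr_ge0.
Qed.


Section Trap.
Context {V : normedModType R} (x : nat -> V) (xb : V) (s : nat -> R).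
Context (a K r : R) (eta : \bar R) (phi : R -> R) (N0 : nat).
Let D n := `|x n.+1 - x n|.
Hypotheses (a0 : 0 < a) (K0 : 0 < K) (r0 : 0 < r) (eta0 : (0 < eta)%E).
Hypothesis phiP : desingularizing eta phi.
Hypothesis s_ge0 : forall n, 0 <= s n.
Hypothesis s_dec : forall n, s n.+1 + a * D n ^+ 2 <= s n.
Hypothesis s_small : forall e, 0 < e -> exists N, forall n, (N <= n)%N -> s n < e.
Hypothesis x_cluster :
  forall e N, 0 < e -> exists n, (N <= n)%N /\ `|x n - xb| < e.
Hypothesis KL_ineq : forall n, (N0 <= n)%N ->
  `|x n.+1 - xb| < r -> `|x n.+2 - xb| < r ->
  0 < s n.+2 -> ((s n.+2)%:E < eta)%E ->
  1 <= derive1 phi (s n.+2) * (K * (D n.+1 + D n)).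

Let D_ge0 n : 0 <= D n. Proof. exact: normr_ge0. Qed.

Lemma steps_small e : 0 < e -> exists N, forall n, (N <= n)%N -> D n < e.
Proof.
move=> e0; have [|N HN] := s_small (e := a * e ^+ 2).
  by rewrite mulr_gt0// exprn_gt0.
exists N => n /HN sn; rewrite -ltr_sqr ?nnegrE ?(ltW e0)// -(ltr_pM2l a0).
by apply: le_lt_trans sn; have := s_dec n; have := s_ge0 n.+1; lra.
Qed.

(* Inside the KL zone each step satisfies [D n.+2 <= 2 * (E n - E n.+1)]. *)
Let E n := K / a * phi (s n.+2) + D n.+1 / 2 + D n / 4.

Lemma KL_trap e : 0 < e -> e <= r -> exists N, forall n, (N <= n)%N ->
  [/\ `|x n.+1 - xb| < e, D n.+2 <= 2 * (E n - E n.+1) & 0 <= E n].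
Proof.
move=> e_gt0 er.
have Ka : 0 < K / a by rewrite divr_gt0.
(* At the starting index each ingredient of [T] below is under e / 16, and their weighted sum stays
   under e. *)
have e16 : 0 < e / 16 by rewrite divr_gt0.
have [|q q0 Hq] := desingularizing_small eta0 phiP (e := e / 16 / (K / a)).
  by rewrite divr_gt0.
have [N1 HN1] := s_small q0.
have [N2 HN2] := steps_small e16.
have [N [NN xN]] := x_cluster (maxn N0 (maxn N1 N2)) e16.
move: NN; rewrite !geq_max => /andP[NN0 /andP[NN1 NN2]].
have sP n : (N <= n)%N -> [/\ ((s n)%:E < eta)%E, 0 <= phi (s n) &
    K / a * phi (s n) < e / 16].
  move=> Nn; have [] := Hq (s n) (s_ge0 n) (HN1 n (leq_trans NN1 Nn)).
  by move=> ? /andP[? ?]; split=> //; rewrite mulrC -ltr_pdivlMr.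
have DP n : (N <= n)%N -> D n < e / 16.
  by move=> Nn; apply: HN2; exact: leq_trans Nn.
have E0 n : (N <= n)%N -> 0 <= E n.
  move=> Nn; have [|_ p0 _] := sP n.+2; first by rewrite !leqW.
  by rewrite !addr_ge0// ?mulr_ge0 ?invr_ge0// ltW.
have step n : (N <= n)%N -> `|x n.+1 - xb| < e -> `|x n.+2 - xb| < e ->
    D n.+2 <= 2 * (E n - E n.+1).
  move=> Nn h1 h2.
  suff : D n.+2 <= (D n.+1 + D n) / 4
      + K / a * (phi (s n.+2) - phi (s n.+3)) by rewrite /E; lra.
  have [|se _ _] := sP n.+2; first by rewrite !leqW.
  have s3 := s_ge0 n.+3; have dec := s_dec n.+2.
  have sq : 0 <= a * D n.+2 ^+ 2 by rewrite mulr_ge0 ?sqr_ge0 ?ltW.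
  have [s2|s2] := ltP 0 (s n.+2).
    apply: (KL_step a0 K0 _ _ _ dec s3) => //.
      apply: (desingularizing_slope phiP) => //; rewrite s3/=; lra.
    by apply: KL_ineq => //; [exact: leq_trans Nn|exact: lt_le_trans er
      |exact: lt_le_trans er].
  (* The KL inequality is silent at gap 0, but then the gap stays 0 and descent forces the step to
     vanish. *)
  have s2E : s n.+2 = 0 by apply: le_anti; rewrite s2 s_ge0.
  have s3E : s n.+3 = 0 by lra.
  have D2E : D n.+2 ^+ 2 = 0.
    apply/eqP; move: dec; rewrite s2E s3E add0r pmulr_rle0// => D2.
    by rewrite eq_le D2 sqr_ge0.
  rewrite s2E s3E subrr mulr0 addr0.
  have -> : D n.+2 = 0 by apply/eqP; rewrite -sqrf_eq0 D2E.
  by rewrite divr_ge0// addr_ge0.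
(* [T] is the potential that traps the iterates: [T n < e] puts two consecutive iterates in the
   ball, [step] then applies, and together with the triangle inequality it yields
   [T n.+1 <= T n]. *)
pose T n := `|x n.+1 - xb| + 2 * E n + D n.+1.
have TP n : (N <= n)%N -> T n < e -> `|x n.+1 - xb| < e /\ `|x n.+2 - xb| < e.
  move=> Nn; rewrite /T => Tn; have En := E0 _ Nn; have Dn := D_ge0 n.+1.
  split; first lra.
  have -> : x n.+2 - xb = (x n.+2 - x n.+1) + (x n.+1 - xb) by rewrite subrKA.
  by apply: le_lt_trans (ler_normD _ _) _; rewrite -/(D n.+1); lra.
have Tlt k : T (k + N)%N < e.
  elim: k => [|k IH].
    rewrite add0n /T.
    have : `|x N.+1 - xb| <= D N + `|x N - xb|.
      by rewrite -(subrKA (x N)) ler_normD.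
    have [|_ _ h] := sP N.+2; first by rewrite !leqW.
    have := DP N (leqnn _); have := DP N.+1 (leqW (leqnn _)).
    by rewrite /E; lra.
  have [h1 h2] := TP _ (leq_addl _ _) IH.
  apply: le_lt_trans IH; have := step _ (leq_addl _ _) h1 h2.
  have : `|x (k + N).+2 - xb| <= D (k + N).+1 + `|x (k + N).+1 - xb|.
    by rewrite -(subrKA (x (k + N).+1)) ler_normD.
  by rewrite /T addSn; lra.
exists N => n Nn; have := Tlt (n - N)%N; rewrite subnK// => Tn.
by have [h1 h2] := TP _ Nn Tn; split=> //; [exact: step|exact: E0].
Qed.

Lemma KL_cvg : x @ \oo --> xb.
Proof.
apply/cvgrPdist_lt => e e0.
have [||N HN] := KL_trap (e := Num.min e r).
- by rewrite lt_min e0.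
- by rewrite ge_min lexx orbT.
exists N.+1 => // -[//|n] /= /HN[+ _ _].
by rewrite lt_min distrC => /andP[].
Qed.

(** Inside the trap the steps are dominated by differences of [2 * E]; the tail telescopes and
    [E >= 0] bounds it. *)
Lemma KL_finite_length :
  (\sum_(0 <= n <oo) (`|x n.+1 - x n|)%:E < +oo)%E.
Proof.
have [N HN] := KL_trap r0 (lexx r).
have bnd k : \sum_(0 <= i < k) D (N.+2 + i)%N <= 2 * (E N - E (N + k)%N).
  elim: k => [|k IH]; first by rewrite big_nil addn0; lra.
  rewrite big_nat_recr//=; have [_ + _] := HN (N + k)%N (leq_addr _ _).
  by rewrite addnS !addSn; lra.
pose B := \sum_(0 <= i < N.+2) D i + 2 * E N.
apply: (@le_lt_trans _ _ B%:E); last exact: ltry.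
apply: lime_le; first exact: is_cvg_nneseries.
near=> n.
rewrite sumEFin lee_fin.
have Nn : (N.+2 <= n)%N by near: n; exists N.+2.
rewrite (big_cat_nat _ Nn)//= lerD2l.
rewrite -{1}[N.+2]add0n big_addn.
have := bnd (n - N.+2)%N; have [_ _] := HN (N + (n - N.+2))%N (leq_addr _ _).
under [in X in _ -> X]eq_bigr do rewrite addnC.
by rewrite /D; lra.
Unshelve. all: by end_near. Qed.

End Trap.

End KLConvergence.

(** * Linear rate *)

Section LinearRate.
Context {R : realType}.

Lemma derive1_powR_scaled (gam alpha t : R) : 0 < t ->
  derive1 (fun s => gam * s `^ (1 - alpha)) t = gam * ((1 - alpha) * t `^ (- alpha)).
Proof.
move=> t0; rewrite derive1E.
have dp := is_derive1_powR (1 - alpha) t0.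
have dg : is_derive t 1 (gam \*: (fun s : R => s `^ (1 - alpha) : R^o))
    (gam *: ((1 - alpha) * t `^ (1 - alpha - 1))) := is_deriveZ gam dp.
rewrite (_ : (fun _ => _) = gam \*: (fun s : R => s `^ (1 - alpha) : R^o))//.
by rewrite derive_val; congr (_ * (_ * _ `^ _)); ring.
Qed.

(* With exponent at most 1/2, the KL inequality bounds the gap by the square of
   the steps, hence by a difference of gaps. *)
Lemma KL_exponent_gap (gam alpha a K t D0 D1 s0 s1 : R) :
  0 < gam -> 0 <= alpha <= 1 / 2 -> 0 < a -> 0 < K ->
  0 <= D0 -> 0 <= D1 -> 0 < t <= 1 ->
  s1 + a * D0 ^+ 2 <= s0 -> t + a * D1 ^+ 2 <= s1 ->
  1 <= derive1 (fun s => gam * s `^ (1 - alpha)) t * (K * (D1 + D0)) ->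
  t <= 2 * (gam * K) ^+ 2 / a * (s0 - t).
Proof.
move=> g0 /andP[al0 al1] a0 K0 D00 D10 /andP[t0 t1] h0 h1.
rewrite derive1_powR_scaled// => h.
set w := D1 + D0 in h *.
have w0 : 0 <= w by rewrite addr_ge0.
have st0 : 0 < Num.sqrt t by rewrite sqrtr_gt0.
(* This uses [t <= 1] and [alpha <= 1 / 2]: near the limit value every such exponent is at least as
   good as 1/2. *)
have p1 : t `^ (- alpha) <= (Num.sqrt t)^-1.
  rewrite powRN lef_pV2 ?posrE ?powR_gt0// -powR12_sqrt ?(ltW t0)//.
  by apply: ger_powR; rewrite ?t0//; lra.
have h2 : Num.sqrt t <= gam * K * w.
  rewrite -[leLHS]mul1r -ler_pdivlMr// mulrC.
  apply: (le_trans h).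
  have -> : gam * ((1 - alpha) * t `^ (- alpha)) * (K * w) =
    ((1 - alpha) * t `^ (- alpha)) * (gam * K * w) by ring.
  apply: ler_wpM2r; first by rewrite !mulr_ge0// ltW.
  apply: le_trans p1; rewrite ler_piMl ?powR_ge0//; lra.
have h3 : t <= (gam * K) ^+ 2 * w ^+ 2.
  rewrite -{1}[t]sqr_sqrtr ?(ltW t0)// -exprMn ler_sqr ?nnegrE ?sqrtr_ge0//.
  by rewrite !mulr_ge0// ltW.
apply: (le_trans h3).
have -> : 2 * (gam * K) ^+ 2 / a * (s0 - t) = (gam * K) ^+ 2 * (2 * (s0 - t) / a) by ring.
rewrite ler_wpM2l ?sqr_ge0// ler_pdivlMr//.
have : 0 <= a * (D1 - D0) ^+ 2 by rewrite mulr_ge0 ?sqr_ge0 ?ltW.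
by rewrite /w; lra.
Qed.

(** The gap estimate reads (1 + b) s_{n+2} <= b s_n, a contraction by q = b / (1 + b) over two
    indices, hence the ratio rho = sqrt q per index. Steps are bounded by the square root of the
    gap, which explains the exponent n / 2 for the iterates. *)
Lemma linear_rate (V : normedModType R) (x : nat -> V) (xb : V) (s : nat -> R)
    (a K gam alpha : R) (N0 : nat) :
  0 < a -> 0 < K -> 0 < gam -> 0 <= alpha <= 1 / 2 ->
  (forall n, 0 <= s n) ->
  (forall n, s n.+1 + a * `|x n.+1 - x n| ^+ 2 <= s n) ->
  (forall e, 0 < e -> exists N, forall n, (N <= n)%N -> s n < e) ->
  x @ \oo --> xb ->
  (forall n, (N0 <= n)%N -> 0 < s n.+2 ->
    1 <= derive1 (fun s => gam * s `^ (1 - alpha)) (s n.+2)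
           * (K * (`|x n.+2 - x n.+1| + `|x n.+1 - x n|))) ->
  exists g1 g2 rho : R, [/\ 0 < g1, 0 < g2, 0 < rho < 1 &
    forall n, s n.+1 <= g1 * rho ^+ n /\ `|x n - xb| <= g2 * rho `^ (n%:R / 2)].
Proof.
move=> a0 K0 g0 al s_ge0 s_dec s_small xcvg hKL.
have sD n : 0 <= a * `|x n.+1 - x n| ^+ 2 by rewrite mulr_ge0 ?sqr_ge0 ?ltW.
have sS n : s n.+1 <= s n by have := s_dec n; have := sD n; lra.
have [N1 HN1] := s_small 1 ltr01.
pose N := maxn N0 N1.
pose b := 2 * (gam * K) ^+ 2 / a.
have b0 : 0 < b by rewrite divr_gt0// mulr_gt0// exprn_gt0// mulr_gt0.
pose q := b / (1 + b).
have b1 : 0 < 1 + b by lra.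
have q0 : 0 < q by rewrite divr_gt0.
have q1 : q < 1 by rewrite ltr_pdivrMr//; lra.
have sq n : (N <= n)%N -> s n.+2 <= q * s n.
  rewrite geq_max => /andP[n0 n1].
  have [s2|s2] := ltP 0 (s n.+2); last first.
    by apply: (le_trans s2); rewrite mulr_ge0// ltW.
  have t1 : 0 < s n.+2 <= 1 by rewrite s2 ltW// HN1// !leqW.
  have := KL_exponent_gap g0 al a0 K0 (normr_ge0 _) (normr_ge0 _) t1
    (s_dec n) (s_dec n.+1) (hKL n n0 s2).
  rewrite -/b => h; rewrite /q mulrAC ler_pdivlMr//; lra.
pose rho := Num.sqrt q.
have rho0 : 0 < rho by rewrite sqrtr_gt0.
have rho1 : rho < 1 by rewrite -sqrtr1 ltr_sqrt.
have rho2 : rho ^+ 2 = q by rewrite sqr_sqrtr// ltW.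
(* Chosen to cover all indices up to [N.+1], hence both parities at which the two-index contraction
   starts; the added 1 keeps [C] positive when the initial gap is 0. *)
pose C := (s 0%N + 1) / rho ^+ N.+1.
have C0 : 0 < C by rewrite divr_gt0 ?exprn_gt0//; have := s_ge0 0%N; lra.
have s_le0 n : s n <= s 0%N.
  by elim: n => // n; apply: le_trans.
have sC1 n : (n <= N.+1)%N -> s n <= C * rho ^+ n.
  move=> nN; rewrite /C mulrAC ler_pdivlMr ?exprn_gt0//.
  apply: ler_pM => //; first by rewrite exprn_ge0// ltW.
    by have := s_le0 n; lra.
  by rewrite ler_wiXn2l// ltW.
have sC n : s n <= C * rho ^+ n.
  suff [] : s n <= C * rho ^+ n /\ s n.+1 <= C * rho ^+ n.+1 by [].
  elim: n => [|n [IH1 IH2]]; first by split; exact: sC1.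
  split=> //; have [nN|Nn] := leqP n.+2 N.+1; first exact: sC1.
  apply: le_trans (sq n _) _; first by rewrite !ltnS in Nn.
  rewrite -rho2 -(add2n n) exprD mulrCA ler_wpM2l// exprn_ge0// ltW//.
pose sg := Num.sqrt rho.
have sg0 : 0 < sg by rewrite sqrtr_gt0.
have sg1 : sg < 1 by rewrite -sqrtr1 ltr_sqrt.
have sg2 : sg ^+ 2 = rho by rewrite sqr_sqrtr// ltW.
have sgE n : rho `^ (n%:R / 2) = sg ^+ n.
  by rewrite mulrC powRrM powR12_sqrt ?(ltW rho0)// powR_mulrn// ltW.
(* The denominator [1 - sg] writes each geometric bound as a difference of consecutive powers, so
   the distances telescope. *)
pose C2 := Num.sqrt (C / a) / (1 - sg).
have Ca : 0 < C / a by rewrite divr_gt0.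
have sg10 : 0 < 1 - sg by lra.
have C20 : 0 < C2 by rewrite divr_gt0// sqrtr_gt0.
have DC n : `|x n.+1 - x n| <= C2 * (sg ^+ n - sg ^+ n.+1).
  have -> : C2 * (sg ^+ n - sg ^+ n.+1) = Num.sqrt (C / a) * sg ^+ n.
    by rewrite /C2 exprS; field; rewrite gt_eqF.
  rewrite -ler_sqr ?nnegrE ?mulr_ge0 ?sqrtr_ge0 ?exprn_ge0 ?(ltW sg0)//.
  rewrite exprMn sqr_sqrtr ?(ltW Ca)// -exprM mulnC exprM sg2.
  rewrite -(ler_pM2l a0); have -> : a * (C / a * rho ^+ n) = C * rho ^+ n.
    by field; rewrite gt_eqF.
  by have := sC n; have := s_dec n; have := s_ge0 n.+1; lra.
have xC n k : `|x (n + k)%N - x n| <= C2 * (sg ^+ n - sg ^+ (n + k)).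
  elim: k => [|k IH]; first by rewrite addn0 !subrr normr0 mulr0.
  rewrite addnS -(subrKA (x (n + k)%N)); apply: (le_trans (ler_normD _ _)).
  by have := DC (n + k)%N; lra.
exists C, C2, rho; split; rewrite ?rho0 ?rho1// => n; split.
  apply: (le_trans (sC _)); rewrite ler_pM2l// exprS ler_piMl ?exprn_ge0 ?(ltW rho0) ?(ltW rho1)//.
rewrite sgE; apply/ler_addgt0Pr => e e0.
have /cvgrPdist_lt/(_ e e0)[N2 _ HN2] := xcvg.
have h1 := xC n N2; have h2 := HN2 (n + N2)%N (leq_addl _ _).
rewrite /= in h2.
have : `|x n - xb| <= `|x n - x (n + N2)%N| + `|x (n + N2)%N - xb|.
  by rewrite -(subrKA (x (n + N2)%N)) ler_normD.
rewrite [X in _ <= X + _]distrC [X in _ <= _ + X]distrC.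
have : 0 <= C2 * sg ^+ (n + N2) by rewrite mulr_ge0 ?exprn_ge0 ?ltW.
lra.
Qed.

End LinearRate.

(** * Fréchet subdifferentials and gradients *)

Section FrechetSubdifferential.
Context {R : realType}.

(** Stated for any positive [ipnorm], so as to serve both [H] and [H * H]. The neighbourhood is
    measured in the library norm, whereas the error term uses the Hilbert norm. *)
Lemma frechet_subdiff_intro (V : normedModType R) (ip : V -> V -> R)
    (h : V -> \bar R) (x u : V) :
  (forall p, p != 0 -> 0 < ipnorm ip p) -> h x \is a fin_num ->
  (forall e, 0 < e -> exists2 r, 0 < r & forall z, `|z - x| < r ->
     (h x + (ip u (z - x) - e * ipnorm ip (z - x))%:E <= h z)%E) ->
  frechet_subdiff ip h x u.
Proof.
move=> ip0 hx Hu; split=> //; rewrite limf_einfE.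
apply/lee_addgt0Pr => e e0; have [r r0 Hr] := Hu e e0.
rewrite -leeBlDr// sub0e.
apply: (@le_trans _ _ (ereal_inf ((fun z => (h z - h x - (ip u (z - x))%:E)
   * ((ipnorm ip (z - x))^-1)%:E)%E @` [set z | `|z - x| < r /\ z != x]))).
  apply: le_ereal_inf_tmp => _ [z [/= zr zx] <-].
  have n0 : 0 < ipnorm ip (z - x) by rewrite ip0// subr_eq0.
  have := Hr z zr; rewrite -(fineK hx); case: (h z) => [hz| |]; last 2 first.
  - move=> _; rewrite !addye// gt0_mulye ?leey//.
    by rewrite lte_fin invr_gt0.
  - by rewrite leeNy_eq.
  rewrite -?EFinN -?EFinD -?EFinM ?lee_fin ler_pdivlMr//; lra.
apply: ereal_sup_ubound; exists [set z | `|z - x| < r /\ z != x] => //.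
rewrite /dnbhs /within/=; apply/nbhs_normP; exists r => //= z; rewrite /ball_/= distrC => zr zx.
by split.
Qed.

Lemma frechet_subdiff_elim (H : normedModType R) (ip : {dot H for idfun})
    (ipE : norm_of_ip ip) (h : H -> \bar R) (x u : H) :
  frechet_subdiff ip h x u -> forall e, 0 < e -> exists2 r, 0 < r &
    forall z, `|z - x| < r -> (h x + (ip u (z - x) - e * `|z - x|)%:E <= h z)%E.
Proof.
move=> [hx]; rewrite limf_einfE => hu e e0.
have : (- e%:E < ereal_sup [set ereal_inf ((fun z => (h z - h x - (ip u (z - x))%:E)
   * ((ipnorm ip (z - x))^-1)%:E)%E @` W) | W in x^'])%E.
  by apply: lt_le_trans hu; rewrite oppe_lt0 lte_fin.
move=> /ereal_sup_gt[_ [W xW <-] Wgt].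
have /nbhs_normP[r /= r0 Hr] : \forall z \near x, z != x -> W z by [].
exists r => // z zr; have [->|zx] := eqVneq z x.
  by rewrite subrr ip0r// normr0 mulr0 subrr adde0.
have Wz : W z by apply: Hr => //; rewrite /ball_/= distrC.
have n0 : 0 < `|z - x| by rewrite normr_gt0 subr_eq0.
have := lt_le_trans Wgt (ereal_inf_lbound (imageP _ Wz)).
rewrite /= -ipE -(fineK hx); case: (h z) => [hz| |]; last 2 first.
- by rewrite leey.
- by rewrite !addNye gt0_mulNye ?lte_fin ?invr_gt0// ltNge leNye.
rewrite -!EFinN -!EFinD -EFinM lte_fin lee_fin ltr_pdivlMr//; lra.
Qed.

End FrechetSubdifferential.

Section Gradient.
Context {R : realType} {H : normedModType R} (ip : {dot H for idfun}).
Hypothesis ipE : norm_of_ip ip.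

Lemma gradient_expansion (F : H -> R) (x u : H) : is_gradient ip F x u ->
  forall e, 0 < e -> exists2 r, 0 < r &
    forall z, `|z - x| < r -> `|F z - F x - ip u (z - x)| <= e * `|z - x|.
Proof.
move=> [dF dFE] e /(differentiable_expansion dF)[r r0 Hr].
by exists r => // z /Hr; rewrite dFE.
Qed.

(** Moving from [x] in the direction w = u - v, the two expansions give t |w|^2 <= 2 e t |w|, which
    is absurd for e = |w| / 4. *)
Lemma frechet_subdiff_gradient (g : H -> \bar R) (x u v : H) :
  (\forall y \near x, g y \is a fin_num) -> is_gradient ip (fine \o g) x v ->
  frechet_subdiff ip g x u -> u = v.
Proof.
move=> gfin gv gu; apply/eqP; rewrite -subr_eq0 -normr_eq0.
have gx := nbhs_singleton gfin.
rewrite -[_ == 0]orbF -[false]/(false); have [//|w0] := eqVneq `|u - v| 0.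
have {}w0 : 0 < `|u - v| by rewrite lt_neqAle eq_sym w0 normr_ge0.
set w := u - v in w0 *; pose e := `|w| / 4.
have e0 : 0 < e by rewrite divr_gt0.
have [r1 r10 H1] := gradient_expansion gv e0.
have [r2 r20 H2] := frechet_subdiff_elim ipE gu e0.
have /nbhs_normP[r3 /= r30 H3] := gfin.
pose r := Num.min r1 (Num.min r2 r3).
have r0 : 0 < r by rewrite !lt_min r10 r20 r30.
pose t := r / 2 / `|w|; have t0 : 0 < t by rewrite !divr_gt0.
have tw : `|t *: w| = r / 2.
  by rewrite normrZ gtr0_norm// /t divfK// gt_eqF.
have : `|x + t *: w - x| < r by rewrite addrC addKr tw; lra.
rewrite !lt_min => /and3P[l1 l2 l3].
have gz : g (x + t *: w) \is a fin_num by apply: H3; rewrite /ball_/= distrC.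
have := H1 _ l1; have := H2 _ l2; rewrite /= -(fineK gz) -(fineK gx).
rewrite -EFinD lee_fin [x + _ - x]addrC addKr ler_norml => h1 /andP[_ h2].
have : ip w (t *: w) = t * `|w| ^+ 2 by rewrite ipZr ip_norm.
rewrite {1}/w ipBl; move: h1 h2; rewrite normrZ gtr0_norm// /e /= => h1 h2 h3.
have : 0 < t * `|w| ^+ 2 by rewrite mulr_gt0// exprn_gt0.
lra.
Qed.

(** The approximating points eventually enter the open set where [g] is C^1, so their subgradients
    are gradients, and [dg] is continuous at [x]. This removes the choice of g_n in the
    algorithm. *)
Lemma limiting_subdiff_C1 (g : H -> \bar R) (dg : H -> H) (A : set H) (x u : H) :
  C1_near ip g dg A -> A x -> limiting_subdiff ip g x u -> u = dg x.
Proof.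
move=> [W [oW AW WP]] Ax [_ [xs [vs [xsx _ vsP vsu]]]].
have Wx := AW _ Ax; have [_ _ dgc] := WP _ Wx.
have vsE : \forall n \near \oo, dg (xs n) = vs n.
  have : \forall n \near \oo, W (xs n) by apply: xsx; exact: open_nbhs_nbhs.
  apply: filterS => n On; apply/esym/(@frechet_subdiff_gradient g (xs n)) => //.
    have : \forall y \near xs n, W y by exact: open_nbhs_nbhs.
    by apply: filterS => y /WP[].
  by have [] := WP _ On.
have dgx : dg (xs n) @[n --> \oo] --> dg x by exact: (cvg_comp _ _ xsx dgc).
rewrite -(cvg_lim (@norm_hausdorff _ _) vsu).
apply: cvg_lim; first exact: norm_hausdorff.
by apply: cvg_trans dgx; exact: near_eq_cvg.
Qed.

Lemma convex_gradient (F : H -> R) (x u y : H) :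
  convex_function ([set: H] : set (convex_lmodType H)) F ->
  is_gradient ip F x u -> F x + ip u (y - x) <= F y.
Proof.
move=> cF gF; suff : ip u (y - x) <= F y - F x by lra.
have n1 : 0 < 1 + `|y - x| by have := normr_ge0 (y - x); lra.
apply: le_slope => e e0.
have [] := gradient_expansion gF (e := e / (1 + `|y - x|)).
  by rewrite divr_gt0.
move=> r r0 Hr; exists (Num.min 1 (r / (1 + `|y - x|))).
  by rewrite lt_min ltr01 divr_gt0.
move=> t t0; rewrite lt_min => /andP[t1]; rewrite ltr_pdivlMr// => tr.
have := convex_functionP cF (t := t) (x := y) (y := x).
rewrite (ltW t0) (ltW t1) => /(_ isT I I).
have -> : t *: y + (1 - t) *: x = x + t *: (y - x).
  by rewrite scalerBl scale1r scalerBr addrCA.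
have := Hr (x + t *: (y - x)).
rewrite [x + _ - x]addrC addKr normrZ gtr0_norm// ipZr.
have tyx : t * `|y - x| < r by apply: le_lt_trans tr; rewrite ler_pM2l//; lra.
move=> /(_ tyx); rewrite ler_norml => /andP[h1 h2] h3.
have : e / (1 + `|y - x|) * (t * `|y - x|) <= e * t.
  have -> : e / (1 + `|y - x|) * (t * `|y - x|) =
    e * t * (`|y - x| / (1 + `|y - x|)) by ring.
  by rewrite ler_piMr ?mulr_ge0 ?(ltW e0) ?(ltW t0)// ler_pdivrMr//; lra.
lra.
Qed.

Lemma sqnorm_conv (x y : H) (t : R) :
  `|t *: y + (1 - t) *: x| ^+ 2 =
  t * `|y| ^+ 2 + (1 - t) * `|x| ^+ 2 - t * (1 - t) * `|y - x| ^+ 2.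
Proof.
rewrite (sqnormD ipE) (sqnormB ipE) ipZl ipZr !normrZ !exprMn !real_normK ?num_real//.
by ring.
Qed.

(** Convexity of the regularized function along the segment, where [sqnorm_conv] turns the quadratic
    part into an error beta / 2 * t (1 - t) |y - x|^2, followed by [le_slope]. *)
Lemma weakly_convex_gradient (g : H -> \bar R) (D : set H) (beta : R) (x y u : H) :
  weakly_convex_on g D beta -> D x -> D y -> g x \is a fin_num -> g y \is a fin_num ->
  (\forall z \near x, g z \is a fin_num) -> is_gradient ip (fine \o g) x u ->
  fine (g x) + ip u (y - x) <= fine (g y) + beta / 2 * `|y - x| ^+ 2.
Proof.
move=> [b0 cg _] Dx Dy gx gy gfin gg.
have iotaE (z : H) : D z -> iota_ R D z = 0%E by rewrite /iota_ => Dz; case: asboolP.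
suff : ip u (y - x) <= fine (g y) - fine (g x) + beta / 2 * `|y - x| ^+ 2 by lra.
have n1 : 0 < 1 + `|y - x| by have := normr_ge0 (y - x); lra.
have /nbhs_normP[r3 /= r30 H3] := gfin.
apply: le_slope => e e0.
have [] := gradient_expansion gg (e := e / (1 + `|y - x|)).
  by rewrite divr_gt0.
move=> r r0 Hr; exists (Num.min 1 (Num.min (r / (1 + `|y - x|)) (r3 / (1 + `|y - x|)))).
  by rewrite !lt_min ltr01 !divr_gt0.
move=> t t0; rewrite !lt_min => /and3P[t1].
rewrite !ltr_pdivlMr// => tr tr3.
have t01 : 0 <= t <= 1 by rewrite (ltW t0) (ltW t1).
have /= := cg y x t t01.
have sq := sqnorm_conv x y t.
have pE : t *: y + (1 - t) *: x = x + t *: (y - x).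
  by rewrite scalerBl scale1r scalerBr addrCA.
rewrite pE in sq *.
have tn : t * `|y - x| <= t * (1 + `|y - x|) by rewrite ler_pM2l//; lra.
have tyx : `|x + t *: (y - x) - x| = t * `|y - x|.
  by rewrite [x + _ - x]addrC addKr normrZ gtr0_norm.
have gz : g (x + t *: (y - x)) \is a fin_num.
  by apply: H3; rewrite /ball_/= distrC tyx; exact: le_lt_trans tr3.
have := Hr (x + t *: (y - x)).
rewrite tyx => /(_ (le_lt_trans tn tr)).
rewrite [x + _ - x]addrC addKr ipZr /= ler_norml => /andP[h1 h2].
rewrite (iotaE _ Dx) (iotaE _ Dy) !adde0 -(fineK gz) -(fineK gx) -(fineK gy) /iota_.
(* Membership of the intermediate point in [D] comes from the convexity inequality itself: off [D]
   its left side would be +oo and its right side finite. *)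
case: asboolP => Dz; last by rewrite !addye// leye_eq.
rewrite adde0 -?EFinD -?EFinM -?EFinD lee_fin sq => h3.
have : e / (1 + `|y - x|) * (t * `|y - x|) <= e * t.
  have -> : e / (1 + `|y - x|) * (t * `|y - x|) =
    e * t * (`|y - x| / (1 + `|y - x|)) by ring.
  by rewrite ler_piMr ?mulr_ge0 ?(ltW e0) ?(ltW t0)// ler_pdivrMr//; lra.
have : 0 <= beta / 2 * (t * t * `|y - x| ^+ 2).
  by rewrite !mulr_ge0 ?sqr_ge0 ?invr_ge0// ltW.
lra.
Qed.

(** The mean value theorem replaces integration. The correction t A + t^2 B subtracted in [G] is
    such that the Lipschitz bound makes G' nonpositive on (0, 1), whence G(1) <= G(0). *)
Lemma descent_lemma (F : H -> R) (dF : H -> H) (l : R) (u y : H) :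
  (forall x, is_gradient ip F x (dF x)) ->
  (forall x z, `|dF x - dF z| <= l * `|x - z|) ->
  F y <= F u + ip (dF u) (y - u) + l / 2 * `|y - u| ^+ 2.
Proof.
move=> gF lF; set d := y - u.
pose line (t : R) : H := t *: d + u.
pose G (t : R) : R := F (line t) - (t * ip (dF u) d + t ^+ 2 * (l / 2 * `|d| ^+ 2)).
have dline (t : R^o) : is_diff t (line : R^o -> H) (fun h : R => h *: d).
  have h1 : is_diff t ( *:%R ^~ d : R^o -> H) ( *:%R ^~ d) by exact: is_diff_scalel.
  have h2 : is_diff t (cst u : R^o -> H) 0 := is_diff_cst u t.
  by have := is_diffD h1 h2; rewrite addr0.
have dFl (t : R) : is_derive t (1 : R) (F \o line : R -> R^o) (ip (dF (line t)) d).
  have [dFt dFE] := gF (line t).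
  have [dl dlE] := dline t.
  have dc : differentiable (F \o line : R^o -> R^o) (t : R^o).
    exact: differentiable_comp.
  apply: DeriveDef; first exact/derivable1_diffP.
  rewrite deriveE// diff_comp// dlE /= scale1r; exact: dFE.
set A := ip (dF u) d in G *; set B := l / 2 * `|d| ^+ 2 in G *.
have dq (t : R) : is_derive t (1 : R)
    (A \*: (id : R -> R^o) + B \*: ((id : R -> R) ^+ 2 : R -> R^o)) (A + 2 * t * B).
  apply: is_derive_eq; rewrite /GRing.scale/=; ring.
have dG (t : R) : is_derive t (1 : R) G (ip (dF (line t)) d - (A + 2 * t * B)).
  have := is_deriveB (dFl t) (dq t); congr (is_derive _ _ _ _).
  by apply/funext => z; rewrite /G !fctE /= /GRing.scale/= ; ring.
have cG : {within `[0, 1], continuous G}.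
  apply: derivable_within_continuous => t _; exact: ex_derive.
have [c c01] := MVT ltr01 (fun t _ => dG t) cG.
rewrite /G /line scale1r scale0r subr0 mulr1 subrK add0r.
rewrite in_itv/= in c01; have /andP[c0 c1] := c01.
have : ip (dF (line c)) d - ip (dF u) d <= l * c * `|d| ^+ 2.
  rewrite -ipBl; apply: (le_trans (ip_le ipE _ _)).
  rewrite expr2 mulrA ler_wpM2r//; apply: (le_trans (lF _ _)).
  by rewrite /line addrK normrZ gtr0_norm// mulrA.
rewrite -/(line c) /A /B; lra.
Qed.

End Gradient.

(** * Local Lipschitz continuity *)

Section LocalLipschitz.
Context {R : realType} {H : normedModType R} (ip : {dot H for idfun}).
Hypothesis ipE : norm_of_ip ip.

(** The common consequence to which the three alternatives of [assumption3] are reduced. *)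
Definition lipschitz_near (h : H -> \bar R) (x : H) : Prop :=
  exists r L : R, [/\ 0 < r, 0 <= L & forall y z, `|y - x| < r -> `|z - x| < r ->
    `|fine (h y) - fine (h z)| <= L * `|y - z|].

Lemma near_diag (x : H) (P : H -> H -> Prop) :
  (\forall p \near (x, x), P p.1 p.2) ->
  exists2 r, 0 < r & forall y z, `|y - x| < r -> `|z - x| < r -> P y z.
Proof.
move=> [[A B] /= [/nbhs_normP[r1 /= r10 H1] /nbhs_normP[r2 /= r20 H2]] AB].
exists (Num.min r1 r2); first by rewrite lt_min r10.
move=> y z; rewrite !lt_min => /andP[y1 _] /andP[_ z2].
by apply: (AB (y, z)); split; [apply: H1|apply: H2]; rewrite /ball_/= distrC.
Qed.

Lemma strictly_differentiable_lipschitz_near (h : H -> \bar R) (x : H) :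
  strictly_differentiable ip h x -> lipschitz_near h x.
Proof.
move=> [_ [u /cvgrPdist_lt/(_ 1 ltr01) hu]].
have [r r0 Hr] := @near_diag x (fun y z => y != z -> `|0 - (fine (h y) - fine (h z)
  - ip u (y - z)) / ipnorm ip (y - z)| < 1) hu.
exists r, (1 + `|u|); split=> //.
move=> y z yr zr; have [->|yz] := eqVneq y z; first by rewrite !subrr !normr0 mulr0.
have := Hr y z yr zr yz; rewrite /= -ipE sub0r normrN normrM.
have n0 : 0 < `|y - z| by rewrite normr_gt0 subr_eq0.
rewrite [X in _ * X]gtr0_norm ?invr_gt0// ltr_pdivrMr// mul1r => h1.
have := ler_normB (fine (h y) - fine (h z) - ip u (y - z)) (- ip u (y - z)).
by rewrite opprK subrK normrN; have := norm_ip ipE u (y - z); lra.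
Qed.

Lemma locally_lipschitz_near (h : H -> \bar R) (O : set H) (x : H) :
  open O -> O x -> locally_lipschitz_on h O -> lipschitz_near h x.
Proof.
move=> oO Ox [_ /(_ (x, x) (conj Ox Ox))] hl.
have [M [M0 hM]] : exists M, 0 <= M /\ \forall p \near within (O `*` O) (nbhs (x, x)),
    `|fine (h p.1) - fine (h p.2)| <= M * `|p.1 - p.2|.
  case: hl => M1 [M1r HM1]; exists (Num.max 0 M1 + 1); split.
    by rewrite addr_ge0// le_max lexx.
  apply: HM1; have : M1 <= Num.max 0 M1 by rewrite le_max lexx orbT.
  lra.
have : \forall p \near (x, x), `|fine (h p.1) - fine (h p.2)| <= M * `|p.1 - p.2|.
  have OO : \forall p \near (x, x), (O `*` O) p.
    by exists (O, O) => //=; split; exact: open_nbhs_nbhs.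
  have hM' : \forall p \near (x, x), (O `*` O) p ->
    `|fine (h p.1) - fine (h p.2)| <= M * `|p.1 - p.2| by exact: hM.
  by apply: filterS2 OO hM' => p Op; exact.
move=> /(@near_diag x (fun y z => `|fine (h y) - fine (h z)| <= M * `|y - z|)).
by move=> [r r0 Hr]; exists r, M.
Qed.

(** By convexity F y - F z <= <dF y, y - z>, so a bound of the gradient on the unit ball around [x]
    is a Lipschitz constant there. *)
Lemma gradient_lipschitz_near (F : H -> R) (dF : H -> H) (l : R) (x : H) :
  0 <= l ->
  convex_function ([set: H] : set (convex_lmodType H)) F ->
  (forall x, is_gradient ip F x (dF x)) ->
  (forall x z, `|dF x - dF z| <= l * `|x - z|) ->
  lipschitz_near (fun y => (F y)%:E) x.
Proof.
move=> l0 cF gF lF; exists 1, (`|dF x| + l); split=> //; first exact: addr_ge0.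
have dFb y : `|y - x| < 1 -> `|dF y| <= `|dF x| + l.
  move=> yx; have := ler_normD (dF y - dF x) (dF x); rewrite subrK => h.
  apply: (le_trans h); rewrite addrC lerD2l; apply: (le_trans (lF _ _)).
  by rewrite ler_piMr// ltW.
suff W y z : `|y - x| < 1 -> F y - F z <= (`|dF x| + l) * `|y - z|.
  move=> y z y1 z1; rewrite /= ler_norml W// andbT lerNl opprB [X in _ * X]distrC.
  exact: W.
move=> y1; have := convex_gradient z cF (gF y).
have := ip_ge ipE (dF y) (z - y); rewrite distrC.
have : `|dF y| * `|y - z| <= (`|dF x| + l) * `|y - z| by rewrite ler_wpM2r ?dFb.
lra.
Qed.

End LocalLipschitz.

(** * One proximal step *)

Section Step.
Context {R : realType} {H : normedModType R} (ip : {dot H for idfun}).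
Hypothesis ipE : norm_of_ip ip.

Lemma sqnorm_shift (a x z : H) :
  `|z - a| ^+ 2 = `|x - a| ^+ 2 + 2 * ip (x - a) (z - x) + `|z - x| ^+ 2.
Proof. by rewrite -(sqnormD ipE) [x - a + _]addrC subrKA. Qed.

Lemma ipnorm2_ge (p : H * H) : `|p.1| <= ipnorm (ip2 ip) p.
Proof.
by rewrite ipE ler_wsqrtr// /ip2 lerDl ip_ge0.
Qed.

Lemma ipnorm2_gt0 (p : H * H) : p != 0 -> 0 < ipnorm (ip2 ip) p.
Proof.
move=> p0; rewrite sqrtr_gt0 /ip2 !(ip_norm ipE).
case: p p0 => [p q] /=; have [->|p0 _] := eqVneq p 0; last first.
  by rewrite ltr_wpDr ?sqr_ge0// exprn_gt0// normr_gt0.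
have [->|q0 _] := eqVneq q 0; first by rewrite eqxx.
by rewrite normr0 expr0n/= add0r exprn_gt0// normr_gt0.
Qed.

Lemma ipnorm2_le (p q : H) : ipnorm (ip2 ip) (p, q) <= `|p| + `|q|.
Proof.
have -> : `|p| + `|q| = Num.sqrt ((`|p| + `|q|) ^+ 2).
  by rewrite sqrtr_sqr ger0_norm ?addr_ge0.
rewrite ler_wsqrtr// /ip2 !(ip_norm ipE)/= sqrrD.
have : 0 <= `|p| * `|q| by rewrite mulr_ge0.
by rewrite -mulr_natl; lra.
Qed.

Section Subgradient.
Variables (Z : set H) (F fs : H -> R) (dfs : H -> H) (l : R).
Hypothesis fs_convex : convex_function ([set: H] : set (convex_lmodType H)) fs.
Hypothesis fs_gradient : forall x, is_gradient ip fs x (dfs x).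
Hypothesis dfs_lipschitz : forall x z, `|dfs x - dfs z| <= l * `|x - z|.

Definition prox_model (tau theta : R) (u v gn y : H) : R :=
  fs u + ip (dfs u) (y - u) + 1 / (2 * tau) * `|y - v - (tau * theta) *: gn| ^+ 2
    + l / 2 * `|y - u| ^+ 2.

(** What Fermat's rule for the proximal objective at [x1] yields as a subgradient of f = fs + fn:
    the gradient of fs minus that of [prox_model]. *)
Definition prox_subgradient (tau theta : R) (u v gn x1 : H) : H :=
  dfs x1 - dfs u - tau^-1 *: (x1 - v) + theta *: gn - l *: (x1 - u).

(** [F - fs] plays the role of fn. Minimality bounds it below by a difference of values of
    [prox_model], which is quadratic, so its expansion at [x1] is exact; convexity of fs supplies
    the rest. All of this holds for any distance to [x1]. *)
Lemma prox_lower_bound (tau theta : R) (u v gn x1 z : H) : 0 < tau ->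
  F x1 - fs x1 + prox_model tau theta u v gn x1
    <= F z - fs z + prox_model tau theta u v gn z ->
  F x1 + ip (prox_subgradient tau theta u v gn x1) (z - x1)
    - (1 / (2 * tau) + l / 2) * `|z - x1| ^+ 2 <= F z.
Proof.
move=> tau0; rewrite /prox_model => h.
have := convex_gradient z fs_convex (fs_gradient x1).
have h1 := sqnorm_shift u x1 z.
have h2 := sqnorm_shift (v + (tau * theta) *: gn) x1 z.
have E y : y - (v + (tau * theta) *: gn) = y - v - (tau * theta) *: gn.
  by rewrite opprD addrA.
rewrite !E in h2.
have h3 : ip (dfs u) (z - u) = ip (dfs u) (x1 - u) + ip (dfs u) (z - x1).
  by rewrite -ipDr [x1 - u + _]addrC subrKA.
have h4 : ip (prox_subgradient tau theta u v gn x1) (z - x1) =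
  ip (dfs x1) (z - x1) - ip (dfs u) (z - x1)
   - 1 / tau * ip (x1 - v - (tau * theta) *: gn) (z - x1)
   - l * ip (x1 - u) (z - x1).
  rewrite /prox_subgradient.
  rewrite ![ip (_ - l *: _) _]ipBl ipDl ipBl ipBl !ipZl.
  rewrite [ip (x1 - v - _) _]ipBl ipZl.
  by field; lra.
rewrite h4; move: h; rewrite h1 h2 h3.
have -> : 1 / (2 * tau) * (`|x1 - v - (tau * theta) *: gn| ^+ 2 +
  2 * ip (x1 - v - (tau * theta) *: gn) (z - x1) + `|z - x1| ^+ 2) =
  1 / (2 * tau) * `|x1 - v - (tau * theta) *: gn| ^+ 2 +
  1 / tau * ip (x1 - v - (tau * theta) *: gn) (z - x1) +
  1 / (2 * tau) * `|z - x1| ^+ 2 by field; lra.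
lra.
Qed.

(** The term l / 2 |x1 - u|^2 of the model cancels the error of the descent lemma from [u] to [x1].
    What survives is l / 2 |x0 - u|^2, that is, the [kap] term; the [muu] term is the cross product
    created by [v]. *)
Lemma prox_descent (G : H -> R) (beta tau theta kap muu : R) (x0 d gn x1 : H) :
  0 < tau -> 0 <= theta -> F x0 = theta * G x0 ->
  ip gn (x1 - x0) <= G x1 - G x0 + beta / 2 * `|x1 - x0| ^+ 2 ->
  F x1 - fs x1 + prox_model tau theta (x0 + kap *: d) (x0 + muu *: d) gn x1
    <= F x0 - fs x0 + prox_model tau theta (x0 + kap *: d) (x0 + muu *: d) gn x0 ->
  F x1 <= theta * G x1 - (1 / tau - theta * beta) / 2 * `|x1 - x0| ^+ 2
    + l / 2 * kap ^+ 2 * `|d| ^+ 2 + muu / tau * ip d (x1 - x0).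
Proof.
move=> tau0 th0 Fx0 hg; rewrite /prox_model.
set u := x0 + kap *: d; set v := x0 + muu *: d => h.
have h1 := descent_lemma ipE u x1 fs_gradient dfs_lipschitz.
have h2 := convex_gradient x0 fs_convex (fs_gradient u).
have h3 := sqnorm_shift (v + (tau * theta) *: gn) x0 x1.
have E y : y - (v + (tau * theta) *: gn) = y - v - (tau * theta) *: gn.
  by rewrite opprD addrA.
rewrite !E in h3.
have h4 : `|x0 - u| ^+ 2 = kap ^+ 2 * `|d| ^+ 2.
  by rewrite /u opprD addrA subrr add0r normrN normrZ exprMn real_normK ?num_real.
have h5 : ip (x0 - v - (tau * theta) *: gn) (x1 - x0) =
   - muu * ip d (x1 - x0) - tau * theta * ip gn (x1 - x0).
  by rewrite /v opprD addrA subrr add0r ipBl ipNl !ipZl mulNr.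
rewrite h5 in h3; rewrite h3 h4 in h.
have {}h3 : 1 / (2 * tau) * (`|x0 - v - (tau * theta) *: gn| ^+ 2 +
   2 * (- muu * ip d (x1 - x0) - tau * theta * ip gn (x1 - x0)) + `|x1 - x0| ^+ 2)
   = 1 / (2 * tau) * `|x0 - v - (tau * theta) *: gn| ^+ 2
     - muu / tau * ip d (x1 - x0) - theta * ip gn (x1 - x0)
     + 1 / tau / 2 * `|x1 - x0| ^+ 2 by field; lra.
rewrite h3 in h.
have {}hg : theta * ip gn (x1 - x0) <=
   theta * (G x1 - G x0 + beta / 2 * `|x1 - x0| ^+ 2) by rewrite ler_wpM2l.
lra.
Qed.

(* [F z / G z - theta = (F z - theta G z) / G z] with [theta = F x1 / G x1 >= 0], so a
   lower expansion of [F] and an upper one of [G] suffice. *)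
Lemma ratio_lower_bound (G : H -> R) (x1 w dg : H) (A : R) :
  0 <= A -> 0 <= F x1 -> (forall z, Z z -> 0 < G z) -> Z x1 ->
  is_gradient ip G x1 dg ->
  (forall z, Z z -> F x1 + ip w (z - x1) - A * `|z - x1| ^+ 2 <= F z) ->
  forall e, 0 < e -> exists2 r, 0 < r & forall z, Z z -> `|z - x1| < r ->
    F x1 / G x1 + ip ((G x1)^-1 *: (w - (F x1 / G x1) *: dg)) (z - x1)
      - e * `|z - x1| <= F z / G z.
Proof.
move=> A0 F0 G0 Zx1 gG hF e e0.
have g0 := G0 _ Zx1; set th := F x1 / G x1; set p := w - th *: dg.
have th0 : 0 <= th by rewrite divr_ge0// ltW.
have F1E : F x1 = th * G x1 by rewrite divfK// gt_eqF.
pose B := `|p| * (`|dg| + 1); have B0 : 0 <= B by rewrite mulr_ge0// addr_ge0.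
pose g := G x1; have {}g0 : 0 < g by [].
pose e1 := e * g / 8 / (1 + th).
have th1 : 0 < 1 + th by lra.
have e10 : 0 < e1 by rewrite !divr_gt0// mulr_gt0.
have [r1 r10 H1] := gradient_expansion gG e10.
have [r2 r20 H2] := gradient_expansion gG ltr01.
have dg1 : 0 < `|dg| + 1 by have := normr_ge0 dg; lra.
have A1 : 0 < A + 1 by lra.
have B1 : 0 < B + 1 by lra.
(* The third bound keeps [G z >= g / 2], so an error of e g / 2 |z - x1| is affordable. It is split
   into e g / 8 for the quadratic term, e g / 8 for the expansion of [G], and e g / 4 for replacing
   [G z] by [g] in the linear term. *)
pose r := Num.min (Num.min r1 r2) (Num.min (g / 2 / (`|dg| + 1))
  (Num.min (e * g / 8 / (A + 1)) (e * g * g / 4 / (B + 1)))).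
have r0 : 0 < r by rewrite !lt_min r10 r20 !divr_gt0// !mulr_gt0.
exists r => // z Zz; rewrite /r !lt_min -!andbA => /and5P[zr1 zr2].
rewrite ltr_pdivlMr// => zr3; rewrite ltr_pdivlMr// => zr4.
rewrite ltr_pdivlMr// => zr5.
set dl := z - x1 in zr1 zr2 zr3 zr4 zr5 *.
have gz0 := G0 _ Zz.
have := H1 z zr1; rewrite -/dl ler_norml => /andP[_ h1].
have hG : `|G z - g| <= (`|dg| + 1) * `|dl|.
  have := H2 z zr2; rewrite -/dl -/g => h2.
  have := ler_normD (G z - g - ip dg dl) (ip dg dl); rewrite subrK.
  by have := norm_ip ipE dg dl; lra.
have gz2 : g / 2 <= G z.
  by move: hG; rewrite ler_norml => /andP[hG _]; lra.
rewrite ler_pdivlMr//.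
have hF1 := hF z Zz; rewrite -/dl F1E -/g in hF1.
rewrite ipZl; have pE : ip p dl = ip w dl - th * ip dg dl by rewrite ipBl ipZl.
set P := ip p dl in pE *.
have hP : `|P| <= `|p| * `|dl| by exact: norm_ip.
have h3 : g^-1 * P * G z <= P + g^-1 * (B * `|dl| ^+ 2).
  have -> : g^-1 * P * G z = P + g^-1 * (P * (G z - g)) by field; lra.
  rewrite lerD2l ler_pM2l ?invr_gt0//; apply: (le_trans (ler_norm _)).
  rewrite normrM /B expr2.
  have -> : `|p| * (`|dg| + 1) * (`|dl| * `|dl|) =
     (`|p| * `|dl|) * ((`|dg| + 1) * `|dl|) by ring.
  exact: ler_pM.
have h4 : A * `|dl| ^+ 2 <= e * g / 8 * `|dl|.
  rewrite expr2 mulrA ler_wpM2r//; have : 0 <= `|dl| by []; lra.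
have h5 : g^-1 * (B * `|dl| ^+ 2) <= e * g / 4 * `|dl|.
  rewrite mulrC ler_pdivrMr// expr2 mulrA.
  have -> : e * g / 4 * `|dl| * g = (e * g * g / 4) * `|dl| by ring.
  rewrite ler_wpM2r//; have : 0 <= `|dl| by []; lra.
have h6 : th * e1 <= e * g / 8.
  have -> : th * e1 = e * g / 8 * (th / (1 + th)) by rewrite /e1; ring.
  rewrite ler_piMr ?divr_ge0 ?mulr_ge0 ?ltW// ltr_pdivrMr//; lra.
have h7 : th * e1 * `|dl| <= e * g / 8 * `|dl| by rewrite ler_wpM2r.
have h8 : e * `|dl| * (g / 2) <= e * `|dl| * G z.
  by rewrite ler_wpM2l// mulr_ge0// ltW.
have h9 : th * (G z - g - ip dg dl) <= th * (e1 * `|dl|) by rewrite ler_wpM2l.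
have : 0 <= e * g * `|dl| by rewrite !mulr_ge0// ltW.
rewrite -/g; lra.
Qed.

End Subgradient.
End Step.

(** * Step sizes and subsequences *)

Section StepSizes.
Context {R : realType}.

(** The first entry of the maximum lets weak convexity consume at most the fraction sqrt(beta) zeta
    of 1 / tau; the second keeps 1 / tau >= delta. *)
Lemma step_size_bound (tau beta theta zeta delta : R) :
  0 < zeta -> 0 < delta -> 0 <= beta -> 0 <= theta ->
  0 < 1 - Num.sqrt beta * zeta ->
  0 < tau <= 1 / Num.max (Num.sqrt beta * theta / zeta) delta ->
  delta * (1 - Num.sqrt beta * zeta) <= 1 / tau - theta * beta.
Proof.
move=> z0 d0 b0 th0 q0 /andP[t0]; set N := Num.max _ _ => tN.
have dN : delta <= N by rewrite le_max lexx orbT.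
have bN : Num.sqrt beta * theta / zeta <= N by rewrite le_max lexx.
have N0 : 0 < N by exact: lt_le_trans dN.
have Nt : N <= 1 / tau.
  by rewrite ler_pdivlMr// mulrC -ler_pdivlMr.
have s0 : 0 <= Num.sqrt beta * zeta by rewrite mulr_ge0 ?sqrtr_ge0// ltW.
have h1 : theta * beta <= Num.sqrt beta * zeta * (1 / tau).
  have -> : theta * beta = Num.sqrt beta * zeta * (Num.sqrt beta * theta / zeta).
    by rewrite -{1}[beta]sqr_sqrtr//; field; lra.
  by rewrite ler_wpM2l//; exact: le_trans Nt.
have : delta * (1 - Num.sqrt beta * zeta) <= 1 / tau * (1 - Num.sqrt beta * zeta).
  by rewrite ler_pM2r//; exact: le_trans Nt.
lra.
Qed.

Lemma merit_descent_BC (m M l sigma mub kappab theta q kap p F1 G1 D E : R) :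
  0 < m -> 0 < M -> 0 <= l -> 0 < sigma ->
  0 <= mub < sigma * Num.sqrt (m * M) / (2 * M) ->
  sigma <= q -> 0 <= kap <= kappab -> p <= mub -> 0 <= D -> 0 <= E ->
  m <= G1 <= M ->
  F1 <= theta * G1 - q / 2 * E ^+ 2 + l / 2 * kap ^+ 2 * D ^+ 2 + p * (D * E) ->
  F1 / G1 + (sigma / (2 * M) - mub / (2 * Num.sqrt (m * M))) * E ^+ 2 <=
  theta + (l * kappab ^+ 2 / (2 * m) + mub / (2 * Num.sqrt (m * M))) * D ^+ 2.
Proof.
move=> m0 M0 l0 s0 /andP[mu0 mu1] sq /andP[k0 k1] pm D0 E0 /andP[mG GM] hF.
set r := Num.sqrt (m * M) in mu1 *.
have mM0 : 0 < m * M by rewrite mulr_gt0.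
have r0 : 0 < r by rewrite sqrtr_gt0.
have r2 : r * r = m * M by rewrite -expr2 sqr_sqrtr// ltW.
have G0 : 0 < G1 by exact: lt_le_trans mG.
(* Weight of Young's inequality for the momentum cross term [D * E]. Since t = sqrt(m / M), dividing
   the [D] part by m and the [E] part by M gives both the same coefficient mub / (2 sqrt(m M)). *)
set t := r / M; have t0 : 0 < t by rewrite divr_gt0.
have mu2 : mub <= sigma * t / 2.
  have -> : sigma * t / 2 = sigma * r / (2 * M) by rewrite /t; field; lra.
  exact: ltW.
have h1 : F1 <= theta * G1 - (sigma - mub / t) / 2 * E ^+ 2
   + (l * kappab ^+ 2 + mub * t) / 2 * D ^+ 2.
  have E2 : q * E ^+ 2 >= sigma * E ^+ 2 by rewrite ler_wpM2r ?sqr_ge0.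
  have K2 : l / 2 * kap ^+ 2 * D ^+ 2 <= l / 2 * kappab ^+ 2 * D ^+ 2.
    rewrite ler_wpM2r ?sqr_ge0// ler_wpM2l ?divr_ge0// ler_sqr ?nnegrE//.
    exact: le_trans k1.
  have P2 : p * (D * E) <= mub * (D * E) by rewrite ler_wpM2r ?mulr_ge0.
  have Y : mub * (D * E) <= mub * (t * D ^+ 2 + E ^+ 2 / t) / 2.
    rewrite -mulrA ler_wpM2l// -subr_ge0.
    have -> : (t * D ^+ 2 + E ^+ 2 / t) / 2 - D * E = (t * D - E) ^+ 2 / (2 * t).
      by field; lra.
    by rewrite divr_ge0 ?sqr_ge0//; lra.
  lra.
have smu : 0 <= sigma - mub / t.
  have : mub / t <= sigma / 2 by rewrite ler_pdivrMr//; lra.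
  lra.
have h2 : F1 / G1 <= theta - (sigma - mub / t) / 2 / M * E ^+ 2
   + (l * kappab ^+ 2 + mub * t) / 2 / m * D ^+ 2.
  rewrite ler_pdivrMr//; apply: (le_trans h1).
  set X := (sigma - mub / t) / 2 * E ^+ 2.
  set Y := (l * kappab ^+ 2 + mub * t) / 2 * D ^+ 2.
  have X0 : 0 <= X by rewrite mulr_ge0 ?sqr_ge0 ?divr_ge0.
  have Y0 : 0 <= Y.
    have lk0 : 0 <= l * kappab ^+ 2 by rewrite mulr_ge0 ?sqr_ge0.
    have mt0 : 0 <= mub * t by exact: mulr_ge0 mu0 (ltW t0).
    by rewrite mulr_ge0 ?sqr_ge0//; lra.
  have XM : X / M * G1 <= X.
    by rewrite -mulrA ler_piMr// mulrC ler_pdivrMr// mul1r.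
  have Ym : Y <= Y / m * G1.
    by rewrite -mulrA ler_peMr// mulrC ler_pdivlMr// mul1r.
  have -> : (theta - (sigma - mub / t) / 2 / M * E ^+ 2
   + (l * kappab ^+ 2 + mub * t) / 2 / m * D ^+ 2) * G1 =
    theta * G1 - X / M * G1 + Y / m * G1 by rewrite /X /Y; ring.
  lra.
have e1 : (sigma - mub / t) / 2 / M = sigma / (2 * M) - mub / (2 * r).
  by rewrite /t; field; lra.
have e2 : (l * kappab ^+ 2 + mub * t) / 2 / m
     = l * kappab ^+ 2 / (2 * m) + mub / (2 * r).
  have -> : t = m / r.
    apply: (mulIf (lt0r_neq0 r0)).
    by rewrite /t mulrAC r2 divfK ?mulfK ?lt0r_neq0.
  by field; lra.
by rewrite e1 e2 in h2; lra.
Qed.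

(** For l > 0 this is the upper bound on [kappab], squared and multiplied by l / (2 m). For l = 0
    the bound on [mub] suffices. *)
Lemma merit_descent_coef (m M l sigma mub kappab : R) :
  0 < m -> 0 < M -> 0 <= l -> 0 < sigma ->
  0 <= mub < sigma * Num.sqrt (m * M) / (2 * M) -> 0 <= kappab ->
  (l != 0 -> kappab < Num.sqrt (m * sigma / (l * M)
                                 - 2 * m * mub / (l * Num.sqrt (m * M)))) ->
  l * kappab ^+ 2 / (2 * m) + mub / (2 * Num.sqrt (m * M))
    < sigma / (2 * M) - mub / (2 * Num.sqrt (m * M)).
Proof.
move=> m0 M0 l0 s0 /andP[mu0 mu1] k0 hk.
set r := Num.sqrt (m * M) in mu1 hk *.
have r0 : 0 < r by rewrite sqrtr_gt0 mulr_gt0.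
have mu2 : mub / r < sigma / (2 * M).
  rewrite ltr_pdivrMr//; apply: (lt_le_trans mu1).
  have -> : sigma / (2 * M) * r = sigma * r / (2 * M) by field; lra.
  exact: lexx.
have mur : mub / (2 * r) = mub / r / 2 by field; lra.
have [l00|l1] := eqVneq l 0; first by rewrite mur l00 !mul0r; lra.
have {}l0 : 0 < l by rewrite lt_neqAle eq_sym l1.
have /hk {}hk := l1.
(* [Num.sqrt] is 0 on negative reals, so 0 <= kappab < sqrt X already forces X > 0. *)
have X0 : 0 < m * sigma / (l * M) - 2 * m * mub / (l * r).
  by rewrite -sqrtr_gt0; exact: le_lt_trans hk.
have : kappab ^+ 2 < m * sigma / (l * M) - 2 * m * mub / (l * r).
  by rewrite -[ltRHS]sqr_sqrtr ?(ltW X0)// ltr_sqr ?nnegrE// sqrtr_ge0.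
rewrite -(ltr_pM2l l0) -(ltr_pM2r (_ : 0 < (2 * m)^-1)); last first.
  by rewrite invr_gt0 mulr_gt0.
have -> : l * (m * sigma / (l * M) - 2 * m * mub / (l * r)) / (2 * m) =
  sigma / (2 * M) - mub / r by field; lra.
by rewrite mur; lra.
Qed.

End StepSizes.

Section Subsequences.
Context {R : realType} {H : normedModType R} (ip : {dot H for idfun}).
Hypothesis ipE : norm_of_ip ip.
Hypothesis H_findim : finite_dim H.

Lemma cluster_closed (S : set H) (x : nat -> H) (xb : H) :
  closed S -> (forall n, S (x n)) ->
  (forall r N, 0 < r -> exists n, (N <= n)%N /\ `|x n - xb| < r) -> S xb.
Proof.
move=> cS Sx clx; apply: cS => B /nbhs_normP[r /= r0 rB].
have [n [_ xr]] := clx r 0%N r0.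
by exists (x n); split=> //; apply: rB; rewrite /ball_/= distrC.
Qed.

(** Substitute for the constant M of (BC): values of g above every k along a subsequence would
    contradict continuity at a cluster point. *)
Lemma bounded_image (S : set H) (g : H -> \bar R) (x : nat -> H) (B : R) :
  closed S -> (forall n, S (x n)) -> (forall n, `|x n| <= B) ->
  (forall y, S y -> g y \is a fin_num /\ {for y, continuous g}) ->
  exists M, forall n, fine (g (x n)) <= M.
Proof.
move=> cS Sx xB gc; apply: contrapT => noM.
have unb k : exists n, k%:R < fine (g (x n)).
  apply: contrapT => nok; apply: noM; exists k%:R => n.
  by rewrite leNgt; apply/negP => kn; apply: nok; exists n.
have [w wP] := choice unb.
have [xb clb] := bounded_cluster ipE H_findim (fun k => xB (w k)).
have Sxb : S xb by apply: cluster_closed clb.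
have [gxb gcxb] := gc _ Sxb.
have [r r0 Hr] : exists2 r, 0 < r & forall y, `|y - xb| < r ->
    (g y < (fine (g xb) + 1)%:E)%E.
  have : \forall y \near xb, (g y < (fine (g xb) + 1)%:E)%E.
    apply: (gcxb [set z | (z < (fine (g xb) + 1)%:E)%E]).
    apply: open_nbhs_nbhs; split; first exact: open_ereal_lt_ereal.
    by rewrite /= -{1}(fineK gxb) lte_fin ltrDl.
  move=> /nbhs_normP[r /= r0 Hr]; exists r => // y yr.
  by apply: Hr; rewrite /ball_/= distrC.
pose K := Num.bound `|fine (g xb) + 1|.
have [k [Kk xk]] := clb r K r0.
have := Hr _ xk; rewrite -(fineK (gc _ (Sx _)).1) lte_fin => h1.
have h2 := wP k.
have h3 : fine (g xb) + 1 <= k%:R.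
  apply: (le_trans (ler_norm _)); apply: (le_trans (ltW (archi_boundP (normr_ge0 _)))).
  by rewrite ler_nat.
lra.
Qed.

End Subsequences.

(** * The e-PSG sequence *)

Lemma limn_einf_gt (R : realType) (t : nat -> R) (b b' : R) :
  limn_einf (fun n => (t n)%:E) = b%:E -> b' < b ->
  exists N, forall n, (N <= n)%N -> b' < t n.
Proof.
rewrite /limn_einf /limn_esup -[(- _)%E]/(limf_einf (fun n => (t n)%:E) \oo).
rewrite limf_einfE => tb b'b.
have : (b'%:E < ereal_sup [set ereal_inf ((fun n => (t n)%:E) @` W) | W in \oo])%E.
  by rewrite tb lte_fin.
move=> /ereal_sup_gt[_ [W [N _ NW] <-] Wgt]; exists N => n /NW Wn.
by rewrite -lte_fin; apply: lt_le_trans Wgt _; apply: ereal_inf_lbound; exists n.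
Qed.

Section Algorithm.
Context (R : realType) (H : normedModType R) (ip : {dot H for idfun}).
Hypotheses (H_findim : finite_dim H) (H_norm : norm_of_ip ip).
Variable S : set H.
Hypothesis S_closed : closed S.
Variables (f g : H -> \bar R) (fs : H -> R) (dfs : H -> H) (fn : H -> \bar R) (l : R).
Hypothesis A1 : assumption1 ip S f fs dfs fn l.
Variable beta : R.
Hypothesis A2 : assumption2 ip S g beta.
Variables m M delta zeta mub kappab : R.
Hypothesis params : ePSG_parameters f g S l beta m M delta zeta mub kappab.
Variables (x gs : nat -> H) (tau kappa mu : nat -> R).
Hypothesis x_gen : ePSG_sequence ip S f g fs dfs fn l beta delta zeta mub kappab
             x gs tau kappa mu.
Variable dg : H -> H.
Hypothesis g_C1 : C1_near ip g dg (S `&` edom f).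
Variable c : R.
Hypothesis c_def : c = merit_coef f g S l m M mub kappab.
Hypothesis level_bounded :
     bounded_set [set y | S y /\ (ratio f g S y <= ratio f g S (x 0%N))%E].

Local Notation Z := (S `&` edom f).
Local Notation F := (fine \o f).
Local Notation G := (fine \o g).
Local Notation D n := (`|x n.+1 - x n|).

Lemma fin_f z : Z z -> f z \is a fin_num.
Proof.
move=> [Sz fz]; case: A1 => fE _ [[fnN _] _] _ _.
rewrite fE fin_numD /= fin_numE fnN /=.
by move: fz; rewrite /edom/= fE; case: (fn z) (fnN z).
Qed.

Lemma fnE z : Z z -> fn z = (F z - fs z)%:E.
Proof.
move=> Zz; have := fin_f Zz; case: A1 => fE _ [[fnN _] _] _ _.
by rewrite /= fE; case: (fn z) (fnN z) => //= r _ _; rewrite addrAC subrr add0r.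
Qed.

Lemma feasible z : S z -> (fn z < +oo)%E -> Z z.
Proof.
move=> Sz fz; split=> //; case: A1 => fE _ _ _ _.
by rewrite /edom/= fE lte_add_pinfty// ltry.
Qed.

Lemma F_ge0 z : Z z -> 0 <= F z.
Proof.
by move=> Zz; case: A1 => _ _ _ _ /(_ _ Zz) fz; apply: fine_ge0.
Qed.

Lemma g_fin z : S z -> g z \is a fin_num.
Proof. by case: A2 => _ + _ _ => /[apply] -[]. Qed.

Lemma G_gt0 z : S z -> 0 < G z.
Proof. by case: A2 => _ gS _ _ /gS[gz g0]; rewrite -lte_fin /= fineK. Qed.

Lemma g_continuous z : S z -> {for z, continuous g}.
Proof. by case: A2 => _ _ [W [_ SW Wc]] _ /SW/Wc. Qed.

Lemma beta_ge0 : 0 <= beta.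
Proof. by case: A2 => _ _ _ [[W [_ _ _ []]]|[_ []]]. Qed.

Lemma G_gradient z : Z z -> is_gradient ip G z (dg z).
Proof. by case: g_C1 => W [_ ZW WP] /ZW/WP[]. Qed.

Lemma dg_continuous z : Z z -> {for z, continuous dg}.
Proof. by case: g_C1 => W [_ ZW WP] /ZW/WP[]. Qed.

Lemma G_weak_convexity y z : Z y -> Z z ->
  ip (dg y) (z - y) <= G z - G y + beta / 2 * `|z - y| ^+ 2.
Proof.
move=> Zy Zz; have [Sy _] := Zy; have [Sz _] := Zz.
have gy : \forall w \near y, g w \is a fin_num.
  case: g_C1 => W [oW ZW WP].
  have : \forall w \near y, W w by apply: open_nbhs_nbhs; split=> //; exact: ZW.
  by apply: filterS => w /WP[].
have [E [SE wE]] : exists E, S `<=` E /\ weakly_convex_on g E beta.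
  case: A2 => _ _ _ [[W [_ _ SW wW]]|[_ wS]]; first by exists W.
  by exists S; split=> // y.
have := weakly_convex_gradient H_norm wE (SE _ Sy) (SE _ Sz)
  (g_fin Sy) (g_fin Sz) gy (G_gradient Zy).
by rewrite /=; lra.
Qed.

Let theta n := F (x n) / G (x n).

Lemma x_feasible n : Z (x n).
Proof.
case: x_gen => Z0 step; elim: n => [//|n Zn].
have [_ _ _ _ [Sx /(_ _ Zn.1) hx]] := step n.
apply: feasible => //; rewrite ltNge leye_eq; apply/negP => /eqP fx.
by move: hx; rewrite /ePSG_objective fx fnE// addye// -EFinD leye_eq.
Qed.

Let Zx := x_feasible.

Lemma theta_ge0 n : 0 <= theta n.
Proof. by rewrite divr_ge0 ?F_ge0// ltW// G_gt0//; case: (Zx n). Qed.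

Lemma F_theta n : F (x n) = theta n * G (x n).
Proof. by rewrite divfK// gt_eqF// G_gt0//; case: (Zx n). Qed.

Lemma gsE n : gs n = dg (x n).
Proof.
case: x_gen => _ /(_ n)[gn _ _ _ _].
exact: limiting_subdiff_C1 g_C1 (Zx n) gn.
Qed.

Lemma tau_gt0 n : 0 < tau n.
Proof. by case: x_gen => _ /(_ n)[_ /andP[]]. Qed.

Lemma prox_ineq n z : Z z ->
  F (x n.+1) - fs (x n.+1) + prox_model ip fs dfs l (tau n) (theta n)
      (extrapolate x kappa n) (extrapolate x mu n) (dg (x n)) (x n.+1)
  <= F z - fs z + prox_model ip fs dfs l (tau n) (theta n)
      (extrapolate x kappa n) (extrapolate x mu n) (dg (x n)) z.
Proof.
move=> Zz; case: x_gen => _ /(_ n)[_ _ _ _ [Sx /(_ _ Zz.1)]].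
rewrite /ePSG_objective !fnE// -gsE.
by rewrite -!EFinD lee_fin.
Qed.

Lemma l_ge0 : 0 <= l. Proof. by case: A1 => _ []. Qed.

Lemma one_step_descent n :
  F (x n.+1) <= theta n * G (x n.+1) - (1 / tau n - theta n * beta) / 2 * D n ^+ 2
    + l / 2 * kappa n ^+ 2 * `|x n - x n.-1| ^+ 2
    + mu n / tau n * (`|x n - x n.-1| * D n).
Proof.
case: (A1) => _ [fsg _ fsc l0 fsl] _ _ _.
have := prox_descent H_norm fsc fsg fsl (tau_gt0 n) (theta_ge0 n) (F_theta n)
   (G_weak_convexity (Zx n) (Zx n.+1)) (prox_ineq n (Zx n)).
move=> /le_trans; apply; rewrite lerD2l ler_wpM2l ?ip_le//.
case: x_gen => _ /(_ n)[_ _ _ /andP[mu0 _] _].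
by rewrite divr_ge0// ltW// tau_gt0.
Qed.

Lemma step_size n : delta * (1 - Num.sqrt beta * zeta) <= 1 / tau n - theta n * beta.
Proof.
case: params => d0 z0 q0 _ _; case: x_gen => _ /(_ n)[_ tn _ _ _].
exact: step_size_bound z0 d0 beta_ge0 (theta_ge0 n) q0 tn.
Qed.

Lemma momentum_le n : 0 <= kappa n <= kappab /\ 0 <= mu n / tau n <= mub.
Proof.
case: x_gen => _ /(_ n)[_ _ -> /andP[mu0 mu1] _]; split=> //.
by rewrite divr_ge0 ?(ltW (tau_gt0 n))//= ler_pdivrMr ?tau_gt0.
Qed.

Lemma level_norm_le : exists B : R, forall n, theta n <= theta 0%N -> `|x n| <= B.
Proof.
case: level_bounded => B [_ HB]; exists (B + 1) => n tn.
apply: (HB (B + 1)); first by rewrite ltrDl.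
split; first by case: (Zx n).
rewrite /ratio; case: asboolP => // _; case: asboolP => [_|]; last by case; exact: Zx.
by rewrite lee_fin.
Qed.

(** * Descent and convergence of the merit values h(x_n, x_{n-1}) *)

Let hval n := theta n + c * `|x n - x n.-1| ^+ 2.

(** Without (BC) the argument has two passes: first [theta] decreases, which confines the iterates
    to the bounded level set; then [bounded_image] bounds g along them and makes the decrease
    uniform in [n]. *)
Lemma merit_descent : exists2 a, 0 < a &
  forall n, hval n.+1 + a * D n ^+ 2 <= hval n.
Proof.
case: (params) => d0 z0 q0 hBC hnBC.
pose sigma := delta * (1 - Num.sqrt beta * zeta).
have s0 : 0 < sigma by rewrite mulr_gt0.
move: c_def; rewrite /merit_coef; case: asboolP => [bc|nbc] cE.
  have [[m0 M0 gmM] mu01 k0 k1] := hBC bc; rewrite -[m * delta * _]mulrA in k1.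
  have h0 := merit_descent_coef m0 M0 l_ge0 s0 mu01 k0 k1; rewrite -cE in h0.
  exists (sigma / (2 * M) - mub / (2 * Num.sqrt (m * M)) - c); first by lra.
  move=> n; have [kn /andP[_ mn]] := momentum_le n.
  have gn : m <= G (x n.+1) <= M.
    have [] := gmM _ (Zx n.+1); rewrite -{1 2}(fineK (g_fin (Zx n.+1).1)).
    by rewrite !lee_fin => -> ->.
  have := merit_descent_BC m0 M0 l_ge0 s0 mu01 (step_size n) kn mn
    (normr_ge0 _) (normr_ge0 _) gn (one_step_descent n).
  by rewrite -cE /hval /= -/(theta n.+1); lra.
have [mu0 k0] := hnBC nbc.
have hval_theta n : hval n = theta n by rewrite /hval cE mul0r addr0.
have step n : theta n.+1 * G (x n.+1) <= theta n * G (x n.+1) - sigma / 2 * D n ^+ 2.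
  have := one_step_descent n; have [/andP[kn kn'] /andP[mn mn']] := momentum_le n.
  have -> : kappa n = 0 by apply: le_anti; rewrite kn -k0 kn'.
  have -> : mu n / tau n = 0 by apply: le_anti; rewrite mn -mu0 mn'.
  rewrite [0 ^+ 2]expr2 !mulr0 !mul0r !addr0 F_theta => /le_trans; apply.
  rewrite lerD2l lerN2 ler_wpM2r ?sqr_ge0//.
  by rewrite ler_pM2r ?step_size.
have Gx n : 0 < G (x n) by apply: G_gt0; case: (Zx n).
have th_dec n : theta n.+1 <= theta n.
  rewrite -(ler_pM2r (Gx n.+1)); apply: le_trans (step n) _.
  by rewrite gerDl oppr_le0 mulr_ge0 ?sqr_ge0// divr_ge0// ltW.
have th0 n : theta n <= theta 0%N by elim: n => // n; exact: le_trans.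
have [B HB] := level_norm_le.
have [M' HM'] := bounded_image H_norm H_findim S_closed (fun n => (Zx n).1)
  (fun n => HB n (th0 n)) (fun y Sy => conj (g_fin Sy) (g_continuous Sy)).
have M'0 : 0 < M' by exact: lt_le_trans (Gx 0%N) (HM' 0%N).
exists (sigma / 2 / M'); first by rewrite !divr_gt0.
move=> n; rewrite !hval_theta -(ler_pM2r (Gx n.+1)).
have h : sigma / 2 / M' * D n ^+ 2 * G (x n.+1) <= sigma / 2 * D n ^+ 2.
  have -> : sigma / 2 / M' * D n ^+ 2 * G (x n.+1) =
     sigma / 2 * D n ^+ 2 * (G (x n.+1) / M') by ring.
  have s20 : 0 <= sigma / 2 by lra.
  apply: ler_piMr; first by rewrite mulr_ge0 ?sqr_ge0.
  by rewrite ler_pdivrMr// mul1r; exact: HM'.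
by have := step n; rewrite mulrDl; lra.
Qed.

Lemma c_ge0 : 0 <= c.
Proof.
case: params => _ _ _ hBC _; rewrite c_def /merit_coef; case: asboolP => // bc.
have [[m0 M0 _] /andP[mu0 _] k0 _] := hBC bc.
by rewrite addr_ge0// divr_ge0 ?mulr_ge0 ?sqr_ge0 ?sqrtr_ge0 ?l_ge0// ltW.
Qed.

Lemma momentum_ge0 : 0 <= kappab /\ 0 <= mub.
Proof.
have [/andP[k0 k1] /andP[m0 m1]] := momentum_le 0.
by split; [exact: le_trans k1|exact: le_trans m1].
Qed.

Lemma hval_dec n : hval n.+1 <= hval n.
Proof.
have [a a0 Ha] := merit_descent; have := Ha n.
have : 0 <= a * D n ^+ 2 by rewrite mulr_ge0 ?sqr_ge0// ltW.
lra.
Qed.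

Lemma theta_le_hval n : theta n <= hval n.
Proof. by rewrite lerDl mulr_ge0 ?sqr_ge0// c_ge0. Qed.

Lemma theta_le0 n : theta n <= theta 0%N.
Proof.
apply: le_trans (theta_le_hval n) _.
(* As [0.-1 = 0], the momentum term is absent at the start. *)
have -> : theta 0%N = hval 0%N by rewrite /hval/= subrr normr0 expr0n mulr0 addr0.
by elim: n => // n; apply: le_trans (hval_dec n).
Qed.

Lemma x_bounded : exists B : R, forall n, `|x n| <= B.
Proof.
by have [B HB] := level_norm_le; exists B => n; apply: HB; exact: theta_le0.
Qed.

Lemma hval_limit : exists hb : R, (forall n, hb <= hval n) /\
  forall e, 0 < e -> exists N, forall n, (N <= n)%N -> hval n - hb < e.
Proof.
have h0 n : 0 <= hval n by exact: le_trans (theta_ge0 n) (theta_le_hval n).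
have nh : nonincreasing_seq hval.
  by apply/nonincreasing_seqP => n; exact: hval_dec.
have ch : cvgn hval.
  by apply: nonincreasing_is_cvgn => //; exists 0 => _ [n _ <-].
exists (limn hval); split.
- by move=> n; exact: nonincreasing_cvgn_ge.
- move=> e e0; have /cvgrPdist_lt/(_ e e0)[N _ HN] := ch.
  exists N => n /HN /=; rewrite distrC; exact: le_lt_trans (ler_norm _).
Qed.


(** * Subgradients of the ratio and of the merit function at the iterates *)

Variables (fl : H -> \bar R) (C : set H).
Hypothesis A3 : assumption3 ip S f g fn fl C.
Variable taub : R.
Hypotheses (taub_gt0 : 0 < taub) (tau_liminf : limn_einf (fun n => (tau n)%:E) = taub%:E).
Hypothesis dg_lipschitz : exists eps lg : R, [/\ 0 < eps, 0 < lg &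
     forall y z, Z y -> Z z -> `|y - z| <= eps -> `|dg y - dg z| <= lg * `|y - z| ].

Let D' n := `|x n - x n.-1|.

Let D'_ge0 n : 0 <= D' n. Proof. exact: normr_ge0. Qed.

Lemma fs_continuous : continuous fs.
Proof.
by case: A1 => _ [fsg _ _ _ _] _ _ _ z; apply: differentiable_continuous; case: (fsg z).
Qed.

Lemma inv_tau_bounded : exists Tb N, 0 <= Tb /\ forall n, (N <= n)%N -> 1 / tau n <= Tb.
Proof.
have tb2 : taub / 2 < taub by rewrite ltr_pdivrMr// ltr_pMr// ltr1n.
have [N HN] := limn_einf_gt tau_liminf tb2.
exists (1 / (taub / 2)), N; split; first by rewrite !divr_ge0// ltW.
move=> n /HN tn; rewrite !div1r lef_pV2 ?posrE ?tau_gt0 ?divr_gt0//.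
exact: ltW.
Qed.

Let prox_sub n := prox_subgradient dfs l (tau n) (theta n)
  (extrapolate x kappa n) (extrapolate x mu n) (dg (x n)) (x n.+1).

(** The summand [theta n *: dg (x n)] is removed because it need not be small; every other summand
    of [prox_sub n] is a multiple of a step, with 1 / tau_n bounded from [N] on and mu_n / tau_n
    bounded by [mub]. *)
Lemma prox_residual : exists K N, 0 <= K /\ forall n, (N <= n)%N ->
  `|prox_sub n - theta n *: dg (x n)| <= K * (D n + D' n).
Proof.
have [Tb [N [Tb0 HN]]] := inv_tau_bounded; have [kb0 mb0] := momentum_ge0.
have l0 := l_ge0.
exists (2 * l * (1 + kappab) + Tb + mub), N; split.
  by rewrite !addr_ge0 ?mulr_ge0// addr_ge0.
move=> n /HN tn; have [/andP[k0 k1] /andP[m0 m1]] := momentum_le n.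
set u := extrapolate x kappa n; set v := extrapolate x mu n.
have t0 := tau_gt0 n.
have E (w : nat -> R) : x n.+1 - extrapolate x w n = (x n.+1 - x n) - w n *: (x n - x n.-1).
  by rewrite /extrapolate opprD addrA.
have hu : `|x n.+1 - u| <= D n + kappab * D' n.
  rewrite E; apply: (le_trans (ler_normB _ _)); rewrite lerD2l normrZ ger0_norm//.
  by rewrite ler_wpM2r.
have hv : `|(tau n)^-1 *: (x n.+1 - v)| <= Tb * D n + mub * D' n.
  rewrite E scalerBr scalerA [_^-1 * mu n]mulrC; apply: (le_trans (ler_normB _ _)).
  have a1 : `|(tau n)^-1| = 1 / tau n by rewrite div1r ger0_norm// invr_ge0 ltW.
  have a2 : `|mu n / tau n| = mu n / tau n by rewrite ger0_norm.
  by rewrite normrZ [X in _ + X]normrZ a1 a2 lerD// ler_wpM2r.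
have -> : prox_sub n - theta n *: dg (x n) =
  (dfs (x n.+1) - dfs u) - (tau n)^-1 *: (x n.+1 - v) - l *: (x n.+1 - u).
  by rewrite /prox_sub /prox_subgradient -/u -/v addrAC addrK.
apply: (le_trans (ler_normB _ _)); rewrite [`|l *: _|]normrZ (ger0_norm l0).
have h1 := ler_normB (dfs (x n.+1) - dfs u) ((tau n)^-1 *: (x n.+1 - v)).
have h2 : `|dfs (x n.+1) - dfs u| <= l * `|x n.+1 - u| by case: A1 => _ [].
have h3 : l * `|x n.+1 - u| <= l * (D n + kappab * D' n) by rewrite ler_wpM2l.
have p1 : 0 <= l * (kappab * D n) by rewrite !mulr_ge0.
have p2 : 0 <= l * D' n by rewrite mulr_ge0 ?mulr_ge0.
have p3 : 0 <= Tb * D' n by rewrite mulr_ge0 ?normr_ge0 ?D'_ge0.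
have p4 : 0 <= mub * D n by rewrite mulr_ge0 ?normr_ge0 ?D'_ge0.
lra.
Qed.

(** Quotient rule (G w - F grad G) / G^2 with F = theta G. *)
Let xi n : H := (G (x n.+1))^-1 *: (prox_sub n - theta n.+1 *: dg (x n.+1)).

Lemma xi_lower_bound n e : 0 < e -> exists2 r, 0 < r & forall z, Z z ->
  `|z - x n.+1| < r -> theta n.+1 + ip (xi n) (z - x n.+1) - e * `|z - x n.+1| <= F z / G z.
Proof.
move=> e0; have [_ [fsg _ fsc l0 _] _ _ _] := A1.
have A0 : 0 <= 1 / (2 * tau n) + l / 2.
  by rewrite addr_ge0 ?divr_ge0// mulr_ge0// ltW// tau_gt0.
have G0 z : Z z -> 0 < G z by move=> [Sz _]; exact: G_gt0.
have hF z : Z z -> F (x n.+1) + ip (prox_sub n) (z - x n.+1)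
    - (1 / (2 * tau n) + l / 2) * `|z - x n.+1| ^+ 2 <= F z.
  by move=> Zz; exact: (prox_lower_bound H_norm fsc fsg (tau_gt0 n) (prox_ineq n Zz)).
exact: (ratio_lower_bound H_norm A0 (F_ge0 (Zx n.+1)) G0 (Zx n.+1)
  (G_gradient (Zx n.+1)) hF e0).
Qed.

Lemma ratioE z : Z z -> ratio f g S z = (F z / G z)%:E.
Proof. by move=> Zz; rewrite /ratio; case: asboolP. Qed.

Lemma ratio_off z : ~ Z z -> ratio f g S z = +oo%E.
Proof. by move=> Zz; rewrite /ratio; case: asboolP. Qed.

Lemma ratio_frechet n : frechet_subdiff ip (ratio f g S) (x n.+1) (xi n).
Proof.
apply: frechet_subdiff_intro.
- by move=> p p0; rewrite -H_norm normr_gt0.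
- by rewrite ratioE.
move=> e /(xi_lower_bound n)[r r0 Hr]; exists r => // z zr.
rewrite ratioE// -EFinD; have [Zz|nZz] := pselect (Z z); last first.
  by rewrite ratio_off// leey.
by rewrite ratioE// lee_fin -H_norm addrA; exact: Hr.
Qed.

Lemma meritE y z : Z y -> merit f g S c (y, z) = (F y / G y + c * `|y - z| ^+ 2)%:E.
Proof. by move=> Zy; rewrite /merit/= ratioE. Qed.

(** The square c|y - z|^2 expands exactly with a nonnegative remainder, so the only error is that of
    [xi_lower_bound] in the first variable. *)
Lemma merit_frechet n : frechet_subdiff (ip2 ip) (merit f g S c) (x n.+1, x n)
  (xi n + (2 * c) *: (x n.+1 - x n), - ((2 * c) *: (x n.+1 - x n))).
Proof.
apply: frechet_subdiff_intro.
- exact: ipnorm2_gt0.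
- by rewrite meritE.
move=> e e0; have [r r0 Hr] := xi_lower_bound n e0; exists r => // -[z1 z2] zr.
rewrite meritE// -EFinD; have [Zz|nZz] := pselect (Z z1); last first.
  by rewrite /merit /= ratio_off// addye// leey.
rewrite meritE// lee_fin.
set w := (2 * c) *: (x n.+1 - x n).
have -> : ip2 ip (xi n + w, - w) ((z1, z2) - (x n.+1, x n)) =
  ip (xi n) (z1 - x n.+1) + (ip w (z1 - x n.+1) - ip w (z2 - x n)).
  by rewrite /ip2/= ipDl ipNl addrA.
have zr1 : `|z1 - x n.+1| < r.
  by apply: le_lt_trans zr; rewrite [leRHS]prod_normE/= le_max lexx.
have h1 := Hr _ Zz zr1.
have h2 : e * `|z1 - x n.+1| <= e * ipnorm (ip2 ip) ((z1, z2) - (x n.+1, x n)).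
  by rewrite ler_pM2l//; exact: (ipnorm2_ge H_norm ((z1, z2) - (x n.+1, x n))).
have h3 := sqnorm_shift H_norm 0 (x n.+1 - x n) (z1 - z2).
rewrite !subr0 in h3.
have h4 : z1 - z2 - (x n.+1 - x n) = (z1 - x n.+1) - (z2 - x n).
  by rewrite !opprB addrACA [RHS]addrACA; congr (_ + _); rewrite addrC.
rewrite h4 ipBr in h3.
have h5 : 0 <= c * `|z1 - x n.+1 - (z2 - x n)| ^+ 2 by rewrite mulr_ge0 ?sqr_ge0 ?c_ge0.
rewrite /w ![ip ((2 * c) *: _) _]ipZl h3 -/(theta n.+1).
lra.
Qed.

(** * Limit value, error bound and KL inequality at a cluster point *)

Section Cluster.
Variables (hb : R) (xb : H).
Hypothesis hb_le : forall n, hb <= hval n.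
Hypothesis hb_lim :
  forall e, 0 < e -> exists N, forall n, (N <= n)%N -> hval n - hb < e.
Hypothesis xb_cluster :
  forall r N, 0 < r -> exists n, (N <= n)%N /\ `|x n - xb| < r.

Let s n := hval n - hb.

Lemma gap_ge0 n : 0 <= s n. Proof. by rewrite subr_ge0. Qed.

Lemma steps_cvg0 : D n @[n --> \oo] --> 0.
Proof.
have [a a0 Ha] := merit_descent.
apply/cvgr0Pnorm_lt => e e0.
have [|N HN] := steps_small (x := x) a0 gap_ge0 _ hb_lim e0.
  by move=> n; have := Ha n; rewrite /s; lra.
by exists N => // n /HN; rewrite /= normr_id.
Qed.

Lemma prev_steps_cvg0 : D' n @[n --> \oo] --> 0.
Proof. by rewrite -cvg_shiftS; exact: steps_cvg0. Qed.

Lemma theta_cvg : theta @ \oo --> hb.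
Proof.
have h1 : hval @ \oo --> hb.
  apply/cvgrPdist_lt => e /hb_lim[N HN]; exists N => // n /HN hn.
  by rewrite /= distrC ger0_norm// subr_ge0.
have -> : theta = (fun n => hval n - c * D' n ^+ 2).
  by apply/funext => n; rewrite /hval addrK.
have h2 : c * D' n ^+ 2 @[n --> \oo] --> c * 0 ^+ 2.
  apply: cvgMl_tmp.
  exact: (cvg_comp _ _ prev_steps_cvg0 (@exprn_continuous R 2 0)).
by have := cvgB h1 h2; rewrite expr2 !mulr0 subr0; apply.
Qed.

Lemma cluster_subseq : exists w : nat -> nat, w @ \oo --> \oo /\ x (w k) @[k --> \oo] --> xb.
Proof.
have [w wP] := choice (fun k : nat => xb_cluster k (@harmonic_gt0 R k)).
exists w; split.
  move=> A [N _ NA]; exists N => // n /= Nn; apply: NA => /=.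
  by apply: leq_trans Nn _; have [] := wP n.
apply/cvgrPdist_lt => e e0.
have /cvgrPdist_lt/(_ e e0)[N _ HN] := @cvg_harmonic R.
exists N => // n /HN /=; rewrite sub0r normrN ger0_norm ?harmonic_ge0//.
by rewrite distrC; apply: lt_trans; have [] := wP n.
Qed.

Let S_xb : S xb.
Proof. by apply: cluster_closed xb_cluster => // n; case: (Zx n). Qed.

Lemma G_continuous y : S y -> {for y, continuous G}.
Proof. by move=> Sy; apply: fine_cvg; rewrite fineK ?g_fin//; exact: g_continuous. Qed.

(** Along the subsequence fn(x_n) = theta_n G(x_n) - fs(x_n) converges to a real number; lower
    semicontinuity makes fn finite at [xb] and bounds it by that number. *)
Lemma cluster_feasible : Z xb /\ F xb <= hb * G xb.
Proof.
have [w [woo wxb]] := cluster_subseq.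
pose v := hb * G xb - fs xb.
have cv : theta (w k) * G (x (w k)) - fs (x (w k)) @[k --> \oo] --> v.
  apply: cvgB; [apply: cvgM|].
  - exact: cvg_comp woo theta_cvg.
  - exact: (cvg_comp _ _ wxb (G_continuous S_xb)).
  - exact: (cvg_comp _ _ wxb (fs_continuous (x := xb))).
have hv : (fn xb <= v%:E)%E.
  rewrite leNgt; apply/negP => vfn.
  have [a va afn] : exists2 a, v < a & (a%:E < fn xb)%E.
    case: (fn xb) vfn => // [r|_]; last by exists (v + 1); rewrite ?ltry// ltrDl.
    rewrite lte_fin => vr; exists ((v + r) / 2); first lra.
    by rewrite lte_fin; lra.
  have [_ _ [_ lsc] _ _] := A1; have [V xbV HV] := lsc _ _ afn.
  have nV : \forall k \near \oo, V (x (w k)) by exact: wxb.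
  have na : \forall k \near \oo, theta (w k) * G (x (w k)) - fs (x (w k)) < a.
    exact: cvgr_lt va.
  near \oo => k.
  have : (a%:E < fn (x (w k)))%E by apply: HV; near: k.
  rewrite fnE// lte_fin F_theta; apply/negP; rewrite -leNgt ltW//.
  by near: k.
have Zxb : Z xb by apply: feasible S_xb _; exact: le_lt_trans hv (ltry _).
by split=> //; move: hv; rewrite fnE// lee_fin /v; lra.
Unshelve. all: by end_near. Qed.

Let Zxb : Z xb := cluster_feasible.1.

(** For the missing inequality the global minorant of F at the iterate of index [(w k).+1] is
    evaluated at [xb]. That iterate also tends to [xb] because steps vanish, and [prox_sub] stays
    bounded, so the error [B k] tends to 0. *)
Lemma cluster_value : F xb = hb * G xb.
Proof.
apply: le_anti; rewrite cluster_feasible.2/=.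
have [w [woo wxb]] := cluster_subseq.
have [Tb [N1 [Tb0 HN1]]] := inv_tau_bounded.
have [K [N2 [K0 HN2]]] := prox_residual.
have xS : x (w k).+1 @[k --> \oo] --> xb.
  have dw : x (w k).+1 - x (w k) @[k --> \oo] --> (0 : H).
    by apply/norm_cvg0P; exact: cvg_comp woo steps_cvg0.
  have -> : (fun k => x (w k).+1) = (fun k => x (w k).+1 - x (w k) + x (w k)).
    by apply/funext => k; rewrite subrK.
  by rewrite -[xb]add0r; exact: cvgD.
have thS : theta (w k).+1 @[k --> \oo] --> hb.
  have tS : theta n.+1 @[n --> \oo] --> hb by rewrite cvg_shiftS; exact: theta_cvg.
  exact: cvg_comp woo tS.
have cF : theta (w k).+1 * G (x (w k).+1) @[k --> \oo] --> hb * G xb.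
  by apply: cvgM => //; exact: (cvg_comp _ _ xS (G_continuous S_xb)).
have ce : `|xb - x (w k).+1| @[k --> \oo] --> (0 : R).
  by apply/norm_cvg0P; rewrite -(subrr xb); apply: cvgB => //; exact: cvg_cst.
pose B k := (K * (D (w k) + D' (w k)) + theta 0%N * `|dg (x (w k))|) * `|xb - x (w k).+1|
  + (Tb / 2 + l / 2) * `|xb - x (w k).+1| ^+ 2.
have cB : F xb + B k @[k --> \oo] --> F xb.
  have cD : K * (D (w k) + D' (w k)) + theta 0%N * `|dg (x (w k))| @[k --> \oo] -->
      K * (0 + 0) + theta 0%N * `|dg xb|.
    have cDD : D (w k) + D' (w k) @[k --> \oo] --> (0 + 0 : R).
      apply: cvgD; first exact: cvg_comp woo steps_cvg0.
      exact: cvg_comp woo prev_steps_cvg0.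
    have cdg : `|dg (x (w k))| @[k --> \oo] --> `|dg xb|.
      by apply: cvg_norm; exact: (cvg_comp _ _ wxb (dg_continuous Zxb)).
    have c1 : K * (D (w k) + D' (w k)) @[k --> \oo] --> K * (0 + 0) by apply: cvgMl_tmp.
    have c2 : theta 0%N * `|dg (x (w k))| @[k --> \oo] --> theta 0%N * `|dg xb|.
      by apply: cvgMl_tmp.
    exact: cvgD c1 c2.
  have ce2 : (Tb / 2 + l / 2) * `|xb - x (w k).+1| ^+ 2 @[k --> \oo] -->
      (Tb / 2 + l / 2) * 0 ^+ 2.
    by apply: cvgMl_tmp; exact: (cvg_comp _ _ ce (@exprn_continuous R 2 0)).
  have := cvgD (cvg_cst (F xb)) (cvgD (cvgM cD ce) ce2).
  by rewrite expr2 !mulr0 !addr0; apply.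
have w1 : \forall k \near \oo, (N1 <= w k)%N.
  by apply: (woo [set n | (N1 <= n)%N]); exists N1.
have w2 : \forall k \near \oo, (N2 <= w k)%N.
  by apply: (woo [set n | (N2 <= n)%N]); exists N2.
apply: (ler_cvg_to cF cB); near=> k.
rewrite -F_theta.
have [_ [fsg _ fsc l0 _] _ _ _] := A1.
have := prox_lower_bound H_norm (F := F) (l := l) fsc fsg (tau_gt0 (w k)) (prox_ineq (w k) Zxb).
rewrite -/(prox_sub (w k)) => h.
have wk1 : (N1 <= w k)%N by near: k.
have wk2 : (N2 <= w k)%N by near: k.
have h1 := HN1 _ wk1; have h2 := HN2 _ wk2.
have h3 : `|prox_sub (w k)| <= K * (D (w k) + D' (w k)) + theta 0%N * `|dg (x (w k))|.
  rewrite -[prox_sub _](subrK (theta (w k) *: dg (x (w k)))).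
  apply: (le_trans (ler_normD _ _)); rewrite lerD// normrZ ger0_norm ?theta_ge0//.
  by rewrite ler_wpM2r// theta_le0.
have h4 : - (`|prox_sub (w k)| * `|xb - x (w k).+1|) <= ip (prox_sub (w k)) (xb - x (w k).+1).
  exact: ip_ge.
have h5 : `|prox_sub (w k)| * `|xb - x (w k).+1| <=
  (K * (D (w k) + D' (w k)) + theta 0%N * `|dg (x (w k))|) * `|xb - x (w k).+1|.
  by rewrite ler_wpM2r.
have h6 : (1 / (2 * tau (w k)) + l / 2) * `|xb - x (w k).+1| ^+ 2 <=
   (Tb / 2 + l / 2) * `|xb - x (w k).+1| ^+ 2.
  rewrite ler_wpM2r ?sqr_ge0// lerD2r.
  have -> : 1 / (2 * tau (w k)) = 1 / tau (w k) / 2 by field; have := tau_gt0 (w k); lra.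
  lra.
by rewrite /B; lra.
Unshelve. all: by end_near. Qed.


(** On [Z] the indicator of C vanishes, which leaves F = fs + fl with both summands locally
    Lipschitz. *)
Lemma F_lipschitz_near : exists r L : R, [/\ 0 < r, 0 <= L & forall y z, Z y -> Z z ->
  `|y - xb| < r -> `|z - xb| < r -> `|F y - F z| <= L * `|y - z|].
Proof.
have [fE [fsg _ fsc l0 fsl] _ _ _] := A1.
have [r1 [L1 [r10 L10 H1]]] := gradient_lipschitz_near H_norm xb l0 fsc fsg fsl.
have [[_ fnE'] _ _ _] := A3.
have FE y : Z y -> F y = fs y + fine (fl y).
  move=> Zy; have := fin_f Zy; rewrite /= fE fnE' /iota_.
  case: asboolP => _; last by case: (fl y).
  by rewrite adde0; case: (fl y).
have [r2 [L2 [r20 L20 H2]]] : lipschitz_near fl xb.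
  case: A3 => _ _ _ [[lf _ _]|[[W [oW ZW lf]] _ _]|[[W [oW ZW sd]] _]].
  - exact: (locally_lipschitz_near openT I lf).
  - exact: locally_lipschitz_near oW (ZW _ Zxb) lf.
  - exact: (strictly_differentiable_lipschitz_near H_norm (sd _ (ZW _ Zxb))).
exists (Num.min r1 r2), (L1 + L2); split; [by rewrite lt_min r10|exact: addr_ge0|].
move=> y z Zy Zz; rewrite !lt_min => /andP[y1 y2] /andP[z1 z2].
have -> : F y - F z = (fs y - fs z) + (fine (fl y) - fine (fl z)).
  by rewrite !FE//; ring.
apply: (le_trans (ler_normD _ _)); rewrite mulrDl lerD//; [exact: H1|exact: H2].
Qed.

Lemma relative_error : exists r K N, [/\ 0 < r, 0 < K & forall n, (N <= n)%N ->
  `|x n - xb| < r -> `|x n.+1 - xb| < r -> `|xi n| <= K * (D n + D' n)].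
Proof.
have [r1 [L [r10 L0 HL]]] := F_lipschitz_near.
have [K0 [N1 [K00 HK]]] := prox_residual.
have [eps [lg [eps0 lg0 Hlg]]] := dg_lipschitz.
have /cvgrPdist_lt/(_ eps eps0)[N2 _ HN2] := steps_cvg0.
pose B := `|dg xb| + 1; pose g2 := G xb / 2.
have Gxb : 0 < G xb by exact: G_gt0.
have g20 : 0 < g2 by rewrite divr_gt0.
have B0 : 0 <= B by rewrite addr_ge0.
have [r2 r20 Hdg] : exists2 r, 0 < r & forall y, `|y - xb| < r -> `|dg y| <= B.
  have /cvgrPdist_lt/(_ 1 ltr01)/nbhs_normP[r /= r0 Hr] := dg_continuous Zxb.
  exists r => // y yr; have := Hr y; rewrite /ball_/= distrC => /(_ yr) h.
  have := ler_normB (dg xb) (dg xb - dg y); rewrite opprB addrC subrK /B.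
  lra.
have [r3 r30 HG] : exists2 r, 0 < r & forall y, `|y - xb| < r -> g2 <= G y.
  have /cvgrPdist_lt/(_ g2 g20)/nbhs_normP[r /= r0 Hr] := G_continuous S_xb.
  exists r => // y yr; have := Hr y; rewrite /ball_/= distrC => /(_ yr).
  by rewrite ltr_norml /g2 /= => /andP[_ h]; lra.
pose LG := B + beta / 2 * eps.
have b0 := beta_ge0.
have LG0 : 0 <= LG by rewrite addr_ge0// !mulr_ge0 ?invr_ge0// ltW.
have t0 := theta_ge0 0.
pose LT := (L + theta 0%N * LG) / g2.
have LT0 : 0 <= LT by rewrite divr_ge0 ?(ltW g20)// addr_ge0// mulr_ge0.
pose K1 := K0 + theta 0%N * lg + LT * B.
have K10 : 0 <= K1 by rewrite !addr_ge0// mulr_ge0// ltW.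
exists (Num.min r1 (Num.min r2 r3)), (K1 / g2 + 1), (maxn N1 N2); split.
- by rewrite !lt_min r10 r20.
- by rewrite ltr_wpDl// divr_ge0// ltW.
move=> n; rewrite geq_max !lt_min => /andP[n1 n2] /and3P[x1 x2 x3] /and3P[y1 y2 y3].
have Dn : D n <= eps.
  by have /= := HN2 n n2; rewrite sub0r normrN normr_id => /ltW.
have Dn0 : 0 <= D n by [].
have D'n0 := D'_ge0 n.
have hF : `|F (x n) - F (x n.+1)| <= L * D n by rewrite [D n]distrC; exact: HL.
have hGb y z : Z y -> Z z -> `|y - xb| < r2 -> `|z - y| <= eps ->
    G y - G z <= LG * `|z - y|.
  move=> Zy Zz yr zy; have := G_weak_convexity Zy Zz.
  have := ip_ge H_norm (dg y) (z - y).
  have : `|dg y| * `|z - y| <= B * `|z - y| by rewrite ler_wpM2r// Hdg.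
  have : beta / 2 * `|z - y| ^+ 2 <= beta / 2 * eps * `|z - y|.
    by rewrite expr2 mulrA ler_wpM2r// ler_wpM2l// divr_ge0.
  by rewrite /LG; lra.
have hG : `|G (x n) - G (x n.+1)| <= LG * D n.
  rewrite ler_norml hGb// andbT lerNl opprB [D n]distrC; apply: hGb => //.
  by rewrite distrC.
have g1 := HG _ x3; have g1' := HG _ y3.
have hT : `|theta n - theta n.+1| <= LT * D n.
  have Gn0 : 0 < G (x n) by exact: lt_le_trans g1.
  have E : (theta n - theta n.+1) * G (x n) =
      (F (x n) - F (x n.+1)) - theta n.+1 * (G (x n) - G (x n.+1)).
    by rewrite !F_theta; ring.
  have h1 : `|theta n - theta n.+1| * G (x n) <= (L + theta 0%N * LG) * D n.
    rewrite -{1}(gtr0_norm Gn0) -normrM E; apply: (le_trans (ler_normB _ _)).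
    rewrite mulrDl lerD// normrM ger0_norm ?theta_ge0// -mulrA.
    by rewrite ler_pM// ?theta_ge0// theta_le0.
  have h2 : `|theta n - theta n.+1| * g2 <= `|theta n - theta n.+1| * G (x n).
    by rewrite ler_wpM2l.
  by rewrite /LT mulrAC ler_pdivlMr//; exact: le_trans h1.
have hdg : `|dg (x n) - dg (x n.+1)| <= lg * D n.
  by rewrite [D n]distrC; apply: Hlg => //; rewrite distrC.
have hp : `|prox_sub n - theta n.+1 *: dg (x n.+1)| <= K1 * (D n + D' n).
  have -> : prox_sub n - theta n.+1 *: dg (x n.+1) =
     (prox_sub n - theta n *: dg (x n)) + (theta n *: (dg (x n) - dg (x n.+1))
       + (theta n - theta n.+1) *: dg (x n.+1)).
    by rewrite scalerBr scalerBl !subrKA.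
  apply: (le_trans (ler_normD _ _)); apply: (le_trans (lerD (HK n n1) (ler_normD _ _))).
  rewrite [`|theta n *: _|]normrZ (ger0_norm (theta_ge0 n)).
  rewrite [`|(theta n - theta n.+1) *: _|]normrZ.
  have h1 : theta n * `|dg (x n) - dg (x n.+1)| <= theta 0%N * (lg * D n).
    by rewrite ler_pM// ?theta_ge0// theta_le0.
  have h2 : `|theta n - theta n.+1| * `|dg (x n.+1)| <= LT * D n * B.
    by rewrite ler_pM// Hdg.
  have h3 : 0 <= theta 0%N * lg * D' n := mulr_ge0 (mulr_ge0 t0 (ltW lg0)) D'n0.
  have h4 : 0 <= LT * B * D' n := mulr_ge0 (mulr_ge0 LT0 B0) D'n0.
  by rewrite /K1; lra.
have G10 : 0 < G (x n.+1) by exact: lt_le_trans g1'.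
rewrite /xi normrZ gtr0_norm ?invr_gt0// mulrC ler_pdivrMr//.
apply: (le_trans hp).
have h1 : K1 * (D n + D' n) <= K1 / g2 * (D n + D' n) * G (x n.+1).
  have -> : K1 / g2 * (D n + D' n) * G (x n.+1) =
     K1 * (D n + D' n) * (G (x n.+1) / g2) by ring.
  apply: ler_peMr; first exact: mulr_ge0 K10 (addr_ge0 Dn0 D'n0).
  by rewrite ler_pdivlMr// mul1r.
have h2 : 0 <= (D n + D' n) * G (x n.+1) by rewrite mulr_ge0 ?addr_ge0// ltW.
lra.
Qed.

Lemma merit_diag : merit f g S c (xb, xb) = hb%:E.
Proof.
rewrite meritE// subrr normr0 expr0n mulr0 addr0 cluster_value mulfK//.
by rewrite gt_eqF// G_gt0.
Qed.

Lemma merit_step n : merit f g S c (x n.+1, x n) = (hval n.+1)%:E.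
Proof. by rewrite meritE. Qed.

Lemma KL_inequality phi : KL_with (ip2 ip) (merit f g S c) (xb, xb) phi ->
  exists r K (eta : \bar R) N, [/\ 0 < r, 0 < K, (0 < eta)%E, desingularizing eta phi &
    forall n, (N <= n)%N -> `|x n.+1 - xb| < r -> `|x n.+2 - xb| < r ->
      0 < s n.+2 -> ((s n.+2)%:E < eta)%E ->
      1 <= derive1 phi (s n.+2) * (K * (D n.+1 + D n))].
Proof.
move=> [_ _ _ [U [eta [nU eta0 dphi hU]]]].
have [r1 [K [N [r10 K0 HK]]]] := relative_error.
have nU' : \forall p \near (xb, xb), U (p.1, p.2) by apply: filterS nU => -[].
have [r2 r20 Hr2] := near_diag (P := fun y z => U (y, z)) nU'.
exists (Num.min r1 r2), (K + 4 * c), eta, N; split=> //.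
- by rewrite lt_min r10.
- by rewrite ltr_wpDr// mulr_ge0// c_ge0.
move=> n Nn; rewrite !lt_min => /andP[x1 x2] /andP[y1 y2] s0 seta.
have := hU _ (Hr2 _ _ y2 x2).
rewrite merit_diag merit_step lte_fin -EFinB /=.
have hs : hb < hval n.+2 by rewrite -subr_gt0.
have he : ((hval n.+2)%:E < hb%:E + eta)%E by rewrite -lteBlDl.
move=> /(_ hs he) h.
have dphi0 : 0 <= derive1 phi (s n.+2).
  by have [_ _ _ _ dp] := dphi; have [_ _ /ltW] := dp _ s0 seta.
rewrite -lee_fin EFinM; apply: (le_trans h); rewrite lee_wpmul2l ?lee_fin//.
pose zeta' := (xi n.+1 + (2 * c) *: (x n.+2 - x n.+1), - ((2 * c) *: (x n.+2 - x n.+1))).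
apply: (@le_trans _ _ (ipnorm (ip2 ip) zeta')%:E).
  apply: ereal_inf_lbound; exists zeta' => //.
  have fr := merit_frechet n.+1; split; first by case: fr.
  by exists (fun=> (x n.+2, x n.+1)), (fun=> zeta'); split=> //; exact: cvg_cst.
rewrite lee_fin; apply: (le_trans (ipnorm2_le H_norm _ _)).
have h1 := HK n.+1 (leqW Nn) x1 y1; rewrite /D'/= in h1.
have c0 := c_ge0.
have h2 := ler_normD (xi n.+1) ((2 * c) *: (x n.+2 - x n.+1)).
have hw : `|(2 * c) *: (x n.+2 - x n.+1)| = 2 * c * D n.+1.
  by rewrite normrZ ger0_norm// mulr_ge0.
rewrite normrN hw; rewrite hw in h2.
have h3 : 0 <= c * D n by rewrite mulr_ge0.
lra.
Qed.

Lemma gap_dec a : (forall n, hval n.+1 + a * D n ^+ 2 <= hval n) ->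
  forall n, s n.+1 + a * D n ^+ 2 <= s n.
Proof. by move=> Ha n; have := Ha n; rewrite /s; lra. Qed.

Lemma cluster_limit : KL (ip2 ip) (merit f g S c) (xb, xb) ->
  (\sum_(0 <= n <oo) (D n)%:E < +oo)%E /\ x @ \oo --> xb.
Proof.
move=> [phi /KL_inequality[r [K [eta [N [r0 K0 eta0 dphi HK]]]]]].
have [a a0 /gap_dec Ha] := merit_descent.
split.
  exact: (KL_finite_length a0 K0 r0 eta0 dphi gap_ge0 Ha hb_lim xb_cluster HK).
exact: (KL_cvg a0 K0 r0 eta0 dphi gap_ge0 Ha hb_lim xb_cluster HK).
Qed.

Lemma cluster_stationary : x @ \oo --> xb -> stationary ip f g S xb.
Proof.
move=> xcvg; split=> //; split; first by rewrite ratioE.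
have [r [K [N [r0 K0 HK]]]] := relative_error.
exists (fun n => x n.+1), xi; split.
- by rewrite -(cvg_shiftS x) in xcvg; exact: xcvg.
- rewrite ratioE// cluster_value mulfK; last by rewrite gt_eqF// G_gt0.
  have tS : theta n.+1 @[n --> \oo] --> hb by rewrite cvg_shiftS; exact: theta_cvg.
  have -> : (fun n => ratio f g S (x n.+1)) = (fun n => (theta n.+1)%:E).
    by apply/funext => n /=; rewrite ratioE.
  by apply: cvg_EFin; [exact: nearW|exact: tS].
- exact: ratio_frechet.
apply/norm_cvg0P.
have cK : K * (D n + D' n) @[n --> \oo] --> K * (0 + 0).
  apply: cvgMl_tmp; apply: cvgD; [exact: steps_cvg0|exact: prev_steps_cvg0].
rewrite addr0 mulr0 in cK.
have /cvgrPdist_lt/(_ r r0)[N1 _ HN1] := xcvg.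
apply: (@squeeze_cvgr _ _ _ _ (fun=> 0) (fun n => K * (D n + D' n))) cK => //.
  near=> n; rewrite normr_ge0/=; apply: HK; first by near: n; exists N.
  - by rewrite distrC; apply: HN1; near: n; exists N1.
  - by rewrite distrC; apply: HN1; rewrite /= leqW//; near: n; exists N1.
exact: cvg_cst.
Unshelve. all: by end_near. Qed.

Lemma cluster_rate alpha : x @ \oo --> xb -> alpha <= 1 / 2 ->
  KL_exponent (ip2 ip) (merit f g S c) (xb, xb) alpha ->
  exists gam1 gam2 rho : R,
    [/\ 0 < gam1, 0 < gam2, 0 < rho < 1 & forall n : nat,
      (`|merit f g S c (x n.+1, x n) - merit f g S c (xb, xb)| <= (gam1 * rho ^+ n)%:E)%E
      /\ `|x n - xb| <= gam2 * rho `^ (n%:R / 2) ].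
Proof.
move=> xcvg al2 [/andP[al0 _] [gam gam0 /KL_inequality]].
move=> [r [K [eta [N [r0 K0 eta0 dphi HK]]]]].
have [a a0 /gap_dec Ha] := merit_descent.
have al : 0 <= alpha <= 1 / 2 by rewrite al0.
have [q q0 Hq] := desingularizing_small eta0 dphi ltr01.
have [N1 HN1] := hb_lim q0.
have /cvgrPdist_lt/(_ r r0)[N2 _ HN2] := xcvg.
have [|g1 [g2 [rho [g10 g20 rho01 Hr]]]] :=
  linear_rate (N0 := maxn N (maxn N1 N2)) a0 K0 gam0 al gap_ge0 Ha hb_lim xcvg.
  move=> n; rewrite !geq_max => /and3P[n0 n1 n2] sn.
  apply: HK => //.
  - by rewrite distrC; apply: HN2; rewrite /= leqW.
  - by rewrite distrC; apply: HN2; rewrite /= !leqW.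
  - by have [] := Hq (s n.+2) (gap_ge0 _) (HN1 _ (leqW (leqW n1))).
exists g1, g2, rho; split=> // n; have [h1 h2] := Hr n; split=> //.
rewrite merit_diag merit_step -EFinB lee_fin ger0_norm//; exact: gap_ge0.
Qed.

End Cluster.

Lemma ePSG_convergence :
  (forall xb, Z xb -> KL (ip2 ip) (merit f g S c) (xb, xb)) ->
  (\sum_(0 <= n <oo) (D n)%:E < +oo)%E /\
  exists xoo : H,
    [/\ x @ \oo --> xoo, stationary ip f g S xoo &
        forall alpha : R, alpha <= 1 / 2 ->
          (forall xb, Z xb -> KL_exponent (ip2 ip) (merit f g S c) (xb, xb) alpha) ->
          exists gam1 gam2 rho : R, [/\ 0 < gam1, 0 < gam2, 0 < rho < 1 &
              forall n : nat,
                (`|merit f g S c (x n.+1, x n) - merit f g S c (xoo, xoo)|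
                   <= (gam1 * rho ^+ n)%:E)%E /\
                `|x n - xoo| <= gam2 * rho `^ (n%:R / 2) ] ].
Proof.
move=> hKL; have [B xB] := x_bounded.
have [hb [hb_le hb_lim]] := hval_limit.
have [xb clx] := bounded_cluster H_norm H_findim xB.
have [Zxb _] := cluster_feasible hb_le hb_lim clx.
have [lenx xcvg] := cluster_limit hb_le hb_lim clx (hKL _ Zxb).
split=> //; exists xb; split=> //; first exact: cluster_stationary hb_le hb_lim clx xcvg.
move=> alpha al2 hKLe.
exact: (cluster_rate hb_le hb_lim clx xcvg al2 (hKLe _ Zxb)).
Qed.

End Algorithm.

Theorem theorem5p5
  (R : realType) (H : normedModType R) (ip : {dot H for idfun})
  (H_findim : finite_dim H) (H_norm : norm_of_ip ip)
  (S : set H) (S_nonempty : S !=set0) (S_closed : closed S)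
  (S_convex : convex_set (S : set (convex_lmodType H)))
  (f g : H -> \bar R)
  (fs : H -> R) (dfs : H -> H) (fn : H -> \bar R) (l : R)
  (A1 : assumption1 ip S f fs dfs fn l)
  (beta : R) (A2 : assumption2 ip S g beta)
  (fl : H -> \bar R) (C : set H) (A3 : assumption3 ip S f g fn fl C)
  (m M delta zeta mub kappab : R)
  (params : ePSG_parameters f g S l beta m M delta zeta mub kappab)
  (x gs : nat -> H) (tau kappa mu : nat -> R)
  (x_gen : ePSG_sequence ip S f g fs dfs fn l beta delta zeta mub kappab
             x gs tau kappa mu)
  (taub : R) (taub_gt0 : 0 < taub)
  (tau_liminf : limn_einf (fun n => (tau n)%:E) = taub%:E)
  (dg : H -> H) (g_C1 : C1_near ip g dg (S `&` edom f))
  (c : R) (c_def : c = merit_coef f g S l m M mub kappab)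
  (h_KL : forall xb, (S `&` edom f) xb -> KL (ip2 ip) (merit f g S c) (xb, xb))
  (level_bounded :
     bounded_set [set y | S y /\ (ratio f g S y <= ratio f g S (x 0%N))%E])
  (dg_lipschitz : exists eps lg : R, [/\ 0 < eps, 0 < lg &
     forall y z, (S `&` edom f) y -> (S `&` edom f) z -> `|y - z| <= eps ->
       `|dg y - dg z| <= lg * `|y - z| ]) :
  (\sum_(0 <= n <oo) (`|x n.+1 - x n|)%:E < +oo)%E /\
  exists xoo : H,
    [/\ x @ \oo --> xoo,
        stationary ip f g S xoo &
        forall alpha : R, alpha <= 1 / 2 ->
          (forall xb, (S `&` edom f) xb ->
             KL_exponent (ip2 ip) (merit f g S c) (xb, xb) alpha) ->
          exists gam1 gam2 rho : R,
            [/\ 0 < gam1, 0 < gam2, 0 < rho < 1 &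
              forall n : nat,
                (`|merit f g S c (x n.+1, x n) - merit f g S c (xoo, xoo)|
                   <= (gam1 * rho ^+ n)%:E)%E /\
                `|x n - xoo| <= gam2 * rho `^ (n%:R / 2) ] ].
Proof.
exact: (ePSG_convergence H_findim H_norm S_closed A1 A2 params x_gen g_C1
  c_def level_bounded A3 taub_gt0 tau_liminf dg_lipschitz h_KL).
Qed.
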